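(* Let $K$ be a field, let $G$ be a finite simple graph without isolated vertices, and let $I(G)$ be its edge ideal over $K$. Let $G_1,\ldots,G_s$ be all connected bipartite components of $G$ and let $G_{s+1},\ldots,G_{s+t}$ be all connected nonbipartite components of $G$. For $i=1,\ldots,s$ let $2k_i$ be the maximum length of cycles of $G_i$ (with $k_i:=1$ if $G_i$ is a tree), and for $i=s+1,\ldots,s+t$ let $2k_i-1$ be the maximum length of odd cycles of $G_i$. Then $$\operatorname{dstab}(I(G)) \leqslant \upsilon(G)-\varepsilon_0(G)-\sum_{i=1}^{s+t}k_i+1.$$
   Context: Simple graph: finite, undirected, no loops, no multiple edges. For a graph $G$ with vertex set $V(G)$ and edge set $E(G)$, its edge ideal is $I(G)=(x_ix_j\mid \{i,j\}\in E(G))$ in $R=K[x_j\mid j\in V(G)]$. For a homogeneous ideal $I\subseteq R$, $\operatorname{dstab}(I)=\min\{n_0\geqslant 1\mid \operatorname{depth} R/I^n=\operatorname{depth} R/I^{n_0}\text{ for all } n\geqslant n_0\}$. $\upsilon(G)$ is the number of vertices of $G$; a leaf is a vertex of degree one, a leaf edge is an edge incident with a leaf, and $\varepsilon_0(G)$ is the number of leaf edges of $G$. A tree is a connected graph without cycles. *)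

(* Defs.v *)
From HB Require Import structures.
From mathcomp Require Import all_boot all_order all_algebra.
From mathcomp Require Import mpoly.

Set Implicit Arguments.
Unset Strict Implicit.
Unset Printing Implicit Defensive.

Import GRing.Theory.

Section CommutativeAlgebra.
Local Open Scope ring_scope.
Variable R : comNzRingType.
Implicit Types (S I J M : R -> Prop) (s : seq R).

Definition ideal_gen S : R -> Prop := fun f =>
  exists (k : nat) (a g : 'I_k -> R),
    (forall i, S (g i)) /\ f = \sum_(i < k) a i * g i.

Definition ideal_exp I (n : nat) : R -> Prop :=
  ideal_gen (fun f => exists g : 'I_n -> R,
    (forall i, I (g i)) /\ f = \prod_(i < n) g i).

Definition ideal_adjoin J s : R -> Prop :=
  ideal_gen (fun g => J g \/ g \in s).

(* [s] is a regular sequence on the module R/J. *)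
Definition regular_seq J s : Prop :=
  (forall i, (i < size s)%N -> forall g,
     ideal_adjoin J (take i s) (s`_i * g) -> ideal_adjoin J (take i s) g)
  /\ ~ ideal_adjoin J s 1.

Definition regular_seq_in M J s : Prop :=
  (forall f, f \in s -> M f) /\ regular_seq J s.

(* The depth of R/J with respect to M is d.  A relation, so that no default
   value is ever chosen: if R/J = 0, no d satisfies it. *)
Definition is_depth M J (d : nat) : Prop :=
  (exists2 s, regular_seq_in M J s & size s = d)
  /\ (forall s, regular_seq_in M J s -> (size s <= d)%N).

End CommutativeAlgebra.

Section DepthStability.
Local Open Scope ring_scope.
Variables (K : fieldType) (n : nat).
Implicit Types I J : {mpoly K[n]} -> Prop.

Definition irrelevant_ideal : {mpoly K[n]} -> Prop :=
  ideal_gen (fun f => exists i : 'I_n, f = 'X_i).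

Definition depth_quot J (d : nat) : Prop := is_depth irrelevant_ideal J d.

Definition depth_stable_from I (n0 : nat) : Prop :=
  forall m, (n0 <= m)%N ->
    exists2 d, depth_quot (ideal_exp I m) d & depth_quot (ideal_exp I n0) d.

Definition is_dstab I (n0 : nat) : Prop :=
  [/\ (1 <= n0)%N, depth_stable_from I n0
    & forall n1, (1 <= n1)%N -> depth_stable_from I n1 -> (n0 <= n1)%N].

End DepthStability.

(* A simple graph is a symmetric irreflexive relation on a finite type. *)
Section Graphs.
Variables (V : finType) (e : rel V).

Definition edge_set : {set {set V}} :=
  [set [set p.1; p.2] | p : V * V & e p.1 p.2].

Definition degree (x : V) : nat := #|[set y | e x y]|.

Definition leaf (x : V) : bool := degree x == 1.

Definition leaf_edges : {set {set V}} :=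
  [set E in edge_set | [exists x in E, leaf x]].

Definition components : {set {set V}} :=
  equivalence_partition (connect e) [set: V].

Implicit Type C : {set V}.

(* [ucycleb] alone also accepts the closed walk x, y, x of length 2. *)
Definition has_cycle C (m : nat) : bool :=
  (2 < m) && [exists c : m.-tuple V, ucycleb e c && all (mem C) c].

Definition bipartite C : bool :=
  [exists A : {set V}, [forall x in C, forall y in C,
     e x y ==> ((x \in A) != (y \in A))]].

(* The vertices of a cycle are distinct, so its length is at most #|V|. *)
Definition acyclic C : bool := [forall m : 'I_#|V|.+1, ~~ has_cycle C m].

Definition max_cycle C : nat := \max_(m < #|V|.+1 | has_cycle C m) m.

Definition max_odd_cycle C : nat :=
  \max_(m < #|V|.+1 | has_cycle C m && odd m) m.

(* The number k_i of a component: the longest cycle of a bipartite component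
   has length 2 k_i, the longest odd cycle of a nonbipartite one has length
   2 k_i - 1.  A connected component is a tree iff it is acyclic. *)
Definition comp_k C : nat :=
  if bipartite C then (if acyclic C then 1 else (max_cycle C)./2)
  else (max_odd_cycle C).+1./2.

End Graphs.

Section EdgeIdeal.
Local Open Scope ring_scope.
Variables (K : fieldType) (V : finType) (e : rel V).

(* The variable of the vertex x is ['X_(enum_rank x)]. *)
Definition edge_ideal : {mpoly K[#|V|]} -> Prop :=
  ideal_gen (fun f => exists x y : V,
    e x y /\ f = 'X_(enum_rank x) * 'X_(enum_rank y)).

End EdgeIdeal.

Arguments edge_ideal K [V] e f : rename.

(* Main.v *)
(** The depth of [R/I^m] equals the number [s] of bipartite components for all
    large [m]. Membership of a monomial in [I^m] is a matching problem.

    Depth at least [s], for every [m > 0]: in a bipartite component [C],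
    Koenig's theorem says that the order of a monomial with respect to [I(C)]
    is its minimum weight on a vertex cover of [C]. Hence every monomial can be
    multiplied by some variable of [C] missed by a minimum cover without
    changing its order. Choosing the least such variable gives a leading term
    for the multiplication by the sum of the variables of [C], and inverting
    the leading term gives a [K]-linear map that preserves [I^m] and is linear
    over the variables of the other components. Therefore the [s] sums of
    variables form a regular sequence on [R/I^m].

    Depth at most [s], for [m] above the bound: in each component take the
    monomial of a longest cycle (a longest odd one if the component is not
    bipartite, a single vertex in a tree) and multiply it by one edge for each
    further nonleaf vertex, joining this vertex to the previous ones. For the
    product [u] of these monomials (times a power of an edge), [I^m : u] is
    generated by the variables of the nonbipartite components and the products
    [x_a x_b] with [a] and [b] on opposite sides of a bipartite component. So
    [R/(I^m : u)] is the Stanley-Reisner ring of a join of [s] complexes, each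
    a disjoint union of two simplices. The cohomology class of this join
    in degree [s - 1], multiplied by [u], is a nonzero class of degree [s] in
    the Koszul cohomology of [R/I^m]; it is detected on a cross-polytope, and it
    bounds the length of every regular sequence by [s]. *)
Require Import Defs.
From mathcomp Require Import all_boot all_order all_algebra.
From mathcomp Require Import mpoly zify ring.
From Stdlib Require Import Classical.

Set Implicit Arguments.
Unset Strict Implicit.
Unset Printing Implicit Defensive.

(** * Matchings and vertex covers *)

Section Matchings.
Variables (V : finType) (e : rel V).
Hypotheses (e_sym : ssrbool.symmetric e) (e_irr : irreflexive e).
Implicit Types (C S H A : {set V}) (w : V -> nat) (E : seq (V * V)).

Definition wt S w := \sum_(v in S) w v.

Lemma wtD S w w' : wt S (fun v => w v + w' v) = wt S w + wt S w'.
Proof. exact: big_split. Qed.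

Lemma wtU S S' w : wt (S :|: S') w <= wt S w + wt S' w.
Proof.
rewrite /wt ![\sum_(v in _) _]big_mkcond -big_split; apply: leq_sum => v _ /=.
by rewrite inE; case: (v \in S); rewrite ?leq_addr.
Qed.

Lemma wtS S S' w : S \subset S' -> wt S w <= wt S' w.
Proof.
move=> /subsetP sS; rewrite /wt [X in X <= _]big_mkcond [X in _ <= X]big_mkcond.
by apply: leq_sum => v _; case: ifP => // /sS->.
Qed.

Lemma wt_pred1 S x : wt S (fun v => x == v) = (x \in S).
Proof.
rewrite /wt; have [xS|xS] := boolP (x \in S).
  by rewrite (bigD1 x) //= eqxx big1 ?addn0 // => v /andP[_]; rewrite eq_sym => /negPf->.
by rewrite big1 // => v vS; case: eqP xS => // ->; rewrite vS.
Qed.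

Definition dg E v := \sum_(p <- E) ((p.1 == v) + (p.2 == v)).

Lemma dg_cat E E' v : dg (E ++ E') v = dg E v + dg E' v.
Proof. exact: big_cat. Qed.

Lemma wt_dg S E : wt S (dg E) = \sum_(p <- E) ((p.1 \in S) + (p.2 \in S)).
Proof.
rewrite /wt exchange_big; apply: eq_bigr => p _.
by rewrite -!wt_pred1 -wtD.
Qed.

(* The monomial with exponents [w] on [C] is divisible by a product of [k] edges of [C]. *)
Definition edge_div C k w : Prop := exists E,
  [/\ size E = k, all (fun p => [&& e p.1 p.2, p.1 \in C & p.2 \in C]) E
    & forall v, v \in C -> dg E v <= w v].

Lemma edge_div0 C w : edge_div C 0 w.
Proof. by exists [::]; split=> // v _; rewrite /dg big_nil. Qed.

Lemma edge_div_le C k k' w w' : k <= k' -> (forall v, v \in C -> w' v <= w v) ->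
  edge_div C k' w' -> edge_div C k w.
Proof.
move=> lek lew [E [sE aE dE]]; exists (take k E); split.
- by rewrite size_takel // sE.
- by apply/allP => p /mem_take; move/allP: aE; apply.
- move=> v vC; apply: leq_trans (leq_trans (dE v vC) (lew v vC)).
  by rewrite -{2}[E](cat_take_drop k) dg_cat leq_addr.
Qed.

Lemma edge_divD C k k' w w' : edge_div C k w -> edge_div C k' w' ->
  edge_div C (k + k') (fun v => w v + w' v).
Proof.
move=> [E [sE aE dE]] [E' [sE' aE' dE']]; exists (E ++ E'); split.
- by rewrite size_cat sE sE'.
- by rewrite all_cat aE.
- by move=> v vC; rewrite dg_cat leq_add ?dE ?dE'.
Qed.

Lemma edge_div1 C x y : e x y -> x \in C -> y \in C ->
  edge_div C 1 (fun v => (x == v) + (y == v)).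
Proof.
move=> exy xC yC; exists [:: (x, y)]; split=> //=; first by rewrite exy xC yC.
by move=> v _; rewrite /dg big_seq1.
Qed.

Lemma edge_divS C k w w' x y : edge_div C k w' -> e x y -> x \in C -> y \in C ->
  (forall v, v \in C -> w' v + ((x == v) + (y == v)) <= w v) -> edge_div C k.+1 w.
Proof.
move=> Dw exy xC yC lew; apply: (edge_div_le (k' := k.+1) _ lew) => //.
by rewrite -addn1; apply: edge_divD => //; apply: edge_div1.
Qed.

(** Each of the [k] edges contributes at least [d] to the weight of [S]. With [d = 1] this bounds
    [k] by the weight of a cover, with [d = 2] and [S] everything by half the degree. *)
Lemma edge_div_wt C k d S w :
  (forall x y, x \in C -> y \in C -> e x y -> d <= (x \in S) + (y \in S)) ->
  edge_div C k w -> d * k <= wt (C :&: S) w.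
Proof.
move=> Sd [E [<- aE dE]].
apply: (@leq_trans (wt (C :&: S) (dg E))).
  rewrite wt_dg -sum1_size big_distrr /= !big_seq; apply: leq_sum => p pE.
  have /and3P[ep p1 p2] := allP aE p pE.
  by rewrite muln1 !inE p1 p2 Sd.
by apply: leq_sum => v; rewrite inE => /andP[vC _]; apply: dE.
Qed.

Definition vcover C S : bool :=
  [forall x in C, forall y in C, e x y ==> (x \in S) || (y \in S)].

Lemma vcoverP C S :
  reflect (forall x y, x \in C -> y \in C -> e x y -> (x \in S) || (y \in S))
          (vcover C S).
Proof.
apply: (iffP forall_inP) => [H x y xC yC exy|H x xC].
  by have /forall_inP/(_ y yC)/implyP/(_ exy) := H x xC.
by apply/forall_inP => y yC; apply/implyP => exy; apply: H.
Qed.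

Lemma edge_div_vcover C k S w : vcover C S -> edge_div C k w -> k <= wt (C :&: S) w.
Proof.
move=> /vcoverP cS /(@edge_div_wt _ _ 1 S); rewrite mul1n; apply.
by move=> x y xC yC exy; have := cS x y xC yC exy; case: (x \in S); case: (y \in S).
Qed.

Definition two_colored C A : Prop :=
  forall x y, x \in C -> y \in C -> e x y -> (x \in A) != (y \in A).

Lemma two_coloredC C A : two_colored C A -> two_colored C (~: A).
Proof. by move=> bA x y xC yC exy; rewrite !inE (inj_eq negb_inj) bA. Qed.

Lemma bipartiteP C : reflect (exists A, two_colored C A) (bipartite e C).
Proof.
apply: (iffP existsP) => [[A /forall_inP HA]|[A colA]]; exists A.
  by move=> x y xC yC exy; have /forall_inP/(_ y yC)/implyP/(_ exy) := HA x xC.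
apply/forall_inP => x xC; apply/forall_inP => y yC; apply/implyP; exact: colA.
Qed.

(* Among the minimum covers through [a], take one with the fewest vertices of
   [A] and the most of its complement: minimum covers form a lattice. *)
Lemma koenig_edge C A w t a S0 : two_colored C A ->
  (forall S, vcover C S -> t <= wt S w) ->
  vcover C S0 -> wt S0 w = t -> a \in S0 -> a \in A -> 0 < w a ->
  exists2 b, [&& a \in C, b \in C, e a b & 0 < w b] &
    forall S, vcover C S -> wt S w = t -> a \in S -> b \notin S.
Proof.
move=> bA mint cS0 tS0 aS0 aA wa.
pose P S := [&& vcover C S, wt S w == t & a \in S].
pose phi S := #|[set v | (v \in S) != (v \in A)]|.
have PS0 : P S0 by rewrite /P cS0 tS0 eqxx aS0.
have [S1 /and3P[cS1 /eqP tS1 aS1] maxS1] := arg_maxnP phi PS0.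
have /existsP[b /and5P[aC bC eab wb bS1]] :
    [exists b, [&& a \in C, b \in C, e a b, 0 < w b & b \notin S1]].
  apply/contraT; rewrite negb_exists => /forallP nob.
  (* If every neighbour of [a] outside [S1] had weight 0, exchanging [a] for these neighbours would
     give a cover of weight below [t]. *)
  pose N := [set b in C | [&& a \in C, e a b & b \notin S1]].
  have cS' : vcover C ((S1 :\ a) :|: N).
    have half x y : x \in C -> y \in C -> e x y -> x \in S1 ->
        (x \in (S1 :\ a) :|: N) || (y \in (S1 :\ a) :|: N).
      move=> xC yC exy xS1; rewrite !inE xS1 andbT.
      case: (eqVneq x a) => //= xa; subst x; rewrite xC yC exy /=.
      case: (y \in S1); rewrite ?andbF ?orbT //= andbT orbF.
      by case: eqVneq exy => // ->; rewrite e_irr.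
    apply/vcoverP => x y xC yC exy; have /orP[xS|yS] := vcoverP _ _ cS1 x y xC yC exy.
      exact: half.
    by rewrite orbC half // e_sym.
  have := mint _ cS'; rewrite leqNgt => /negP[]; rewrite -tS1 {2}/wt.
  rewrite (big_setD1 a) //= -add1n.
  apply: leq_add => //; apply: (@leq_trans (wt (S1 :\ a) w + wt N w)).
    exact: wtU.
  rewrite addnC -[X in _ <= X]add0n leq_add2r.
  rewrite /wt big1 // => v; rewrite inE => /andP[vC /and3P[aC eav vS1]].
  by have := nob v; rewrite aC vC eav vS1 andbT /= lt0n negbK => /eqP.
exists b; first by rewrite aC bC eab wb.
move=> S cS tS aS; apply/negP => bS.
have bA' : b \notin A by have := bA a b aC bC eab; rewrite aA; case: (b \in A).
(* Uncrossing: both sets are covers and their weights add up to those of [S] and [S1], so [S2] is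
   again minimum. It contains [b], which contradicts the choice of [S1]. *)
pose S2 := [set v | if v \in A then (v \in S) && (v \in S1) else (v \in S) || (v \in S1)].
pose S3 := [set v | if v \in A then (v \in S) || (v \in S1) else (v \in S) && (v \in S1)].
have cov23 : vcover C S2 /\ vcover C S3.
  split; apply/vcoverP => x y xC yC exy; rewrite !inE;
  have := vcoverP _ _ cS x y xC yC exy; have := vcoverP _ _ cS1 x y xC yC exy;
  have := bA x y xC yC exy; do !case: (_ \in _) => //.
have wt23 : wt S2 w + wt S3 w = wt S w + wt S1 w.
  rewrite /wt ![\sum_(v in _) _]big_mkcond -!big_split; apply: eq_bigr => v _ /=.
  rewrite !inE; case: (v \in A); case: (v \in S); case: (v \in S1) => //=; exact: addnC.
have tS2 : wt S2 w = t.
  have [/mint le2 /mint le3] := cov23; apply/eqP; rewrite eqn_leq le2 andbT.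
  by rewrite -(leq_add2r (wt S3 w)) wt23 tS tS1 leq_add2l.
have : phi S2 <= phi S1.
  by apply: maxS1; rewrite /P tS2 eqxx cov23.1 inE aA aS.
rewrite leqNgt => /negP; apply; apply: proper_card; apply/properP; split.
  apply/subsetP => v; rewrite !inE; case: (v \in A); case: (v \in S); case: (v \in S1) => //.
by exists b; rewrite !inE (negPf bA') ?bS // (negPf bS1).
Qed.

(** Split off an edge [ab] of positive weights that no minimum cover contains entirely. Minimum
    covers lose at most 1, the others at most 2 from a weight that exceeds the minimum, so every
    cover keeps weight at least [m]. *)
Lemma koenig C A w m : two_colored C A ->
  (forall S, vcover C S -> m <= wt S w) -> edge_div C m w.
Proof.
move=> bA; elim: m w => [|m IH] w covm; first exact: edge_div0.
have cT : vcover C setT by apply/vcoverP => x y; rewrite !inE.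
have [S0 cS0 minS0] := arg_minnP (wt^~ w) cT.
have wS0 : 0 < wt S0 w := leq_trans (ltn0Sn m) (covm _ cS0).
have [a aS0 wa] : exists2 a, a \in S0 & 0 < w a.
  apply/exists_inP; apply: contraLR wS0; rewrite negb_exists_in => /forall_inP H.
  by rewrite -leqNgt leqn0 /wt big1 // => v /H; rewrite -leqNgt leqn0 => /eqP.
have [b /and4P[aC bC eab wb] nob] : exists2 b, [&& a \in C, b \in C, e a b & 0 < w b] &
    forall S, vcover C S -> wt S w = wt S0 w -> a \in S -> b \notin S.
  have [aA|aA] := boolP (a \in A).
    exact: (koenig_edge bA minS0 cS0).
  by apply: (koenig_edge (two_coloredC bA) minS0 cS0) => //; rewrite inE.
have ab : (a == b) = false by apply: contraTF eab => /eqP->; rewrite e_irr.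
pose w' v := w v - ((a == v) + (b == v)).
have w'E v : w v = w' v + ((a == v) + (b == v)).
  by rewrite /w' subnK //; case: eqP => [<-|_]; [rewrite eq_sym ab|case: eqP => [<-|]].
apply: (@edge_divS _ _ _ w' a b) => // [|v _]; last by rewrite w'E.
apply: IH => S cS.
have : wt S w = wt S w' + ((a \in S) + (b \in S)).
  by rewrite -!wt_pred1 -!wtD; apply: eq_bigr => v _; rewrite w'E.
have : wt S w = wt S0 w -> (a \in S) + (b \in S) <= 1.
  by move=> /(nob S cS); case: (a \in S) => [/(_ isT)/negPf->|_] //; case: (b \in S).
have : (a \in S) + (b \in S) <= 2 by case: (a \in S); case: (b \in S).
have := minS0 S cS; have := covm _ cS0.
move: (wt S w) (wt S0 w) (wt S w') ((a \in S) + (b \in S)) => p q r d.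
clear; lia.
Qed.

End Matchings.

(** * Longest cycles and the extremal monomial *)

Section OddCycles.
Variables (V : finType) (e : rel V).
Hypotheses (e_sym : ssrbool.symmetric e) (e_irr : irreflexive e).
Implicit Types (C : {set V}) (c : seq V).

Lemma not_uniq_split (T : eqType) (s : seq T) : ~~ uniq s ->
  exists p1 x p2 p3, s = p1 ++ (x :: p2) ++ x :: p3.
Proof.
elim: s => //= y s IH; rewrite negb_and negbK => /orP[|/IH].
  by case/splitPr => p2 p3; exists [::], y, p2, p3.
by move=> [p1 [x [p2 [p3 ->]]]]; exists (y :: p1), x, p2, p3.
Qed.

(* A closed walk of odd length that is not a cycle splits at a repeated vertex
   into two closed walks, one of which has odd length. *)
Lemma odd_closed_walk C c : cycle e c -> odd (size c) -> all (mem C) c ->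
  exists c', [/\ ucycleb e c', odd (size c') & all (mem C) c'].
Proof.
have [n] := ubnP (size c); elim: n c => // n IH c /ltnSE le_n cyc oddc allc.
have [uc|] := boolP (uniq c); first by exists c; rewrite /ucycleb cyc uc.
move=> /not_uniq_split[p1 [x [p2 [p3 def_c]]]].
have cyc' : cycle e ((x :: p2) ++ x :: p3 ++ p1).
  by rewrite -cat_cons catA -(rot_size_cat p1) rot_cycle -def_c.
have allc' : all (mem C) ((x :: p2) ++ x :: p3 ++ p1).
  apply/allP => z; rewrite -cat_cons catA -(rot_size_cat p1) mem_rot -def_c.
  exact: (allP allc).
have size' : size c = size (x :: p2) + size (x :: p3 ++ p1).
  by rewrite def_c !size_cat /= size_cat; lia.
have [cyc1 cyc2] : cycle e (x :: p2) /\ cycle e (x :: p3 ++ p1).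
  move: cyc'; rewrite /= rcons_cat cat_path /= => /and3P[pp ex pq].
  by rewrite pq rcons_path pp ex.
move: allc'; rewrite all_cat => /andP[all1 all2].
have [odd1|even1] := boolP (odd (size (x :: p2))).
  by apply: (IH _ _ cyc1) => //; rewrite (leq_trans _ le_n) // size' /= ?addSn ?addnS !ltnS ?leq_addr ?leq_addl //; lia.
apply: (IH _ _ cyc2) => //; first by rewrite (leq_trans _ le_n) // size' /= ?addSn ?addnS !ltnS ?leq_addr ?leq_addl //; lia.
by move: oddc; rewrite size' oddD (negPf even1).
Qed.

(** The bipartite double cover: every step changes the sheet, so the parity of a walk is read off
    its ends. *)
Let e2 : rel (V * bool) := fun p q => e p.1 q.1 && (p.2 != q.2).

Lemma double_cover_path x b s : path e x s ->
  connect e2 (x, b) (last x s, b (+) odd (size s)).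
Proof.
elim: s x b => [|y s IH] x b /=; first by rewrite addbF.
case/andP => exy /(IH y (~~ b)); rewrite addNb -addbN; apply: connect_trans.
by apply: connect1; rewrite /e2 /= exy; case: b.
Qed.

Lemma double_cover_project p s : path e2 p s ->
  path e p.1 (map fst s) /\ (last p s).2 = p.2 (+) odd (size s).
Proof.
elim: s p => [|q s IH] p /=; first by rewrite addbF.
case/andP => /andP[epq npq] /IH[-> ->]; rewrite epq; split=> //.
by case: p.2 npq; case: q.2 => //=; case: odd.
Qed.

Lemma odd_cycle_exists C :
  (forall x y, x \in C -> e x y -> y \in C) ->
  (forall x y, x \in C -> y \in C -> connect e x y) ->
  ~~ bipartite e C -> exists m : 'I_#|V|.+1, has_cycle e C m && odd m.
Proof.
move=> clC conC nbip.
have e2_sym : connect_sym e2.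
  by apply: sym_connect_sym => p q; rewrite /e2 e_sym eq_sym.
have [r rC] : exists r, r \in C.
  apply/set0Pn; apply: contraNneq nbip => ->.
  by apply/existsP; exists set0; apply/forall_inP => x; rewrite inE.
have : ~~ [forall x in C, forall y in C, e x y ==>
  ((x \in [set v | connect e2 (r, false) (v, false)])
    != (y \in [set v | connect e2 (r, false) (v, false)]))].
  by move: nbip; rewrite negb_exists => /forallP; apply.
rewrite negb_forall_in => /exists_inP[x xC].
rewrite negb_forall_in => /exists_inP[y yC].
rewrite negb_imply negbK !inE => /andP[exy /eqP eqxy].
(* Every vertex of [C] is reached from [(r, false)] on at least one sheet. *)
have reach v : v \in C -> connect e2 (r, false) (v, ~~ connect e2 (r, false) (v, false)).
  move=> vC; have [//|nv] := boolP (connect e2 (r, false) (v, false)).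
  have /connectP[s ps def_v] := conC r v rC vC.
  have := double_cover_path false ps; rewrite -def_v /=.
  by case: odd nv => // /negPf->.
(* The ends of the badly coloured edge are joined by a walk that returns to the same sheet, hence of
   even length; the edge closes it to an odd closed walk. *)
have xy : connect e2 (x, ~~ connect e2 (r, false) (x, false))
                     (y, ~~ connect e2 (r, false) (x, false)).
  apply: (@connect_trans _ _ (r, false)); first by rewrite e2_sym reach.
  by rewrite eqxy reach.
have /connectP[s /[dup] ps /double_cover_project[/= ps' par] def_y] := xy.
rewrite -def_y /= in par.
have lasty : last x (map fst s) = y.
  by have := congr1 fst def_y; rewrite -(last_map fst) /= => <-.
have clpath z q : z \in C -> path e z q -> all (mem C) q.
  elim: q z => //= z' q IH z zC /andP[ezz' pq].
  by rewrite (clC _ _ zC ezz') (IH z') // (clC _ _ zC ezz').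
have [||| c [uc oddc allc]] := @odd_closed_walk C (x :: map fst s).
- by rewrite /= rcons_path ps' lasty e_sym.
- by rewrite /= size_map; move: par; case: (~~ _); case: odd.
- by rewrite /= xC (clpath x).
have lec : size c < #|V|.+1.
  by rewrite ltnS -(card_uniqP (andP uc).2) max_card.
exists (Ordinal lec); rewrite /= oddc andbT /has_cycle; apply/andP; split.
  case: c uc oddc {allc lec} => [|z [|z' [|]]] //=.
  by rewrite /ucycleb /= e_irr.
by apply/existsP; exists (in_tuple c); rewrite uc.
Qed.

End OddCycles.

Section CycleFacts.
Variables (V : finType) (e : rel V).
Hypotheses (e_sym : ssrbool.symmetric e).
Implicit Types (C A S : {set V}) (c : seq V).

Lemma ucycle_rot c v : ucycleb e c -> v \in c ->
  exists s, [/\ ucycleb e (v :: s), perm_eq c (v :: s) & size c = (size s).+1].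
Proof.
move=> uc vc; have [i s def_s] := rot_to vc; exists s.
rewrite -def_s /ucycleb rot_cycle rot_uniq; split=> //.
  by rewrite perm_sym perm_rot.
by rewrite -[RHS]/(size (v :: s)) -def_s size_rot.
Qed.

Lemma cycle_not_leaf c v : ucycleb e c -> 2 < size c -> v \in c -> ~~ leaf e v.
Proof.
move=> uc + vc; have [s [/andP[cyc us] _ ->]] := ucycle_rot uc vc.
case: s cyc us => [|a [|b s]] //= /andP[eva].
rewrite rcons_path => /and3P[_ _ elv] /and3P[_ abs _] _.
apply/negP => /cards1P[z /setP eqz].
have za : z = a by have := eqz a; rewrite !inE eva => /esym/eqP.
have zl : z = last b s by have := eqz (last b s); rewrite !inE e_sym elv => /esym/eqP.
by move: abs; rewrite -za zl mem_last.
Qed.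

Lemma sorted_edge_div C j p : sorted e p -> size p = j.*2 -> all (mem C) p ->
  edge_div e C j (fun u => count_mem u p).
Proof.
elim: j p => [|j IH] p; first by move=> *; exact: edge_div0.
case: p => [|x [|y p]] //= /andP[exy pp] [sp] /and3P[xC yC pC].
apply: (@edge_divS _ _ _ _ _ (fun u => count_mem u p) x y) => //.
  by apply: IH => //; exact: path_sorted pp.
by move=> v _; rewrite addnC addnA.
Qed.

(** Summing over the edges of the cycle the number of ends in [S] counts each vertex twice, and each
    edge contributes at least 1. Equality forces exactly one end per edge. *)
Lemma cycle_cover c S : uniq c ->
  (forall v, v \in c -> (v \in S) || (next c v \in S)) ->
  size c <= (wt S (fun v => v \in c)).*2 /\
  (size c = (wt S (fun v => v \in c)).*2 ->
    forall v, v \in c -> (next c v \in S) = (v \notin S)).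
Proof.
move=> uc cov.
have wtE : (wt S (fun v => v \in c)).*2 = \sum_(v in c) ((v \in S) + (next c v \in S)).
  have -> : wt S (fun v => v \in c) = \sum_(v in c) (v \in S).
    rewrite /wt [LHS]big_mkcond [RHS]big_mkcond; apply: eq_bigr => v _ /=.
    by case: (v \in S); case: (v \in c).
  rewrite big_split -addnn; congr (_ + _).
  rewrite [LHS](reindex_inj (can_inj (prev_next uc))) /=.
  by apply: eq_bigl => v; rewrite mem_next.
have sizeE : size c = \sum_(v in c) 1 by rewrite sum1_card; apply/esym/card_uniqP.
have le1 v : v \in c -> 1 <= (v \in S) + (next c v \in S) ?= iff ((v \in S) + (next c v \in S) == 1).
  move=> vc; split; last by rewrite eq_sym.
  by move: (cov v vc); case: (v \in S); case: (_ \in S).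
have := leqif_sum le1; rewrite -sizeE -wtE => -[le eq]; split=> // sE v vc.
move: eq; rewrite -sE eqxx => /esym/forall_inP/(_ v vc).
by case: (v \in S); case: (_ \in S).
Qed.

Lemma cycle_const (f : V -> bool) c : uniq c ->
  (forall v, v \in c -> f (next c v) = f v) -> {in c &, forall x y, f x = f y}.
Proof.
move=> uc fn x y xc yc.
have := @cycle_from_next _ (fun x y => f x == f y) c uc.
case: c uc fn xc yc => // z c uc fn xc yc cyc.
have {}cyc : path (fun x y => f x == f y) z (rcons c z).
  by apply: cyc => v /fn ->.
have /allP fz : all (fun y => f z == f y) (rcons c z).
  by apply: order_path_min cyc => ? ? ? /eqP-> /eqP->.
have fz' v : v \in z :: c -> f z = f v.
  by rewrite -mem_rcons => /fz/eqP.
by rewrite -(fz' x) // (fz' y).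
Qed.

End CycleFacts.

Section ComponentCore.
Variables (V : finType) (e : rel V).
Hypotheses (e_sym : ssrbool.symmetric e) (e_irr : irreflexive e).
Variable C : {set V}.
Hypotheses (clC : forall x y, x \in C -> e x y -> y \in C)
  (conC : forall x y, x \in C -> y \in C -> connect e x y)
  (C_neq0 : C != set0).
Implicit Types (S H A : {set V}) (w : V -> nat).

(** The exception serves a component that is a single edge, where the growth has to start from a
    leaf. *)
Definition leaf_free H :=
  forall x, x \in H -> leaf e x -> H = [set x] /\ forall y, y \in C -> leaf e y.

Definition dominates H := forall v, v \in C -> v \in H \/ exists2 p, p \in H & e v p.

Lemma leaf_nbr x y z : leaf e x -> e x y -> e x z -> z = y.
Proof.
by move=> /cards1P[t /setP eqt] xy xz; have := eqt y; have := eqt z; rewrite !inE xy xz => /esym/eqP-> /esym/eqP.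
Qed.

(** Each nonleaf vertex that is added costs one edge, so [k] and [#|H|] grow together. The invariant
    [body] is abstract in order to share the growth between bipartite and nonbipartite
    components. *)
Lemma grow_core c (body : {set V} -> (V -> nat) -> nat -> Prop) :
  (forall H w k p z, H \subset C -> body H w k -> p \in H -> z \in C -> z \notin H ->
     e p z -> body (z |: H) (fun v => w v + ((z == v) + (p == v))) k.+1) ->
  forall H w k, H \subset C -> H != set0 -> k + c = #|H| -> leaf_free H -> body H w k ->
  exists H w k, [/\ H \subset C, k + c = #|H|, leaf_free H, dominates H & body H w k].
Proof.
move=> step H; have [n] := ubnP (#|C| - #|H|); elim: n H => // n IH H ltn w k HC H0 kc lfH bH.
have [/existsP[p /existsP[z /and5P[pH zC zH epz nl]]]|maxH] :=
    boolP [exists p, exists z, [&& p \in H, z \in C, z \notin H, e p z & ~~ leaf e z]].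
  have HC' : z |: H \subset C by rewrite subUset sub1set zC.
  apply: (IH (z |: H) _ _ k.+1 HC' _ _ _ (step H w k p z HC bH pH zC zH epz)).
  - by have := subset_leq_card HC'; rewrite cardsU1 zH; clear -ltn; lia.
  - by apply/set0Pn; exists z; rewrite setU11.
  - by rewrite cardsU1 zH addSn kc.
  - move=> x; rewrite !inE => /predU1P[->|xH] lx; first by rewrite lx in nl.
    by have [_ /(_ z zC)] := lfH x xH lx; rewrite (negPf nl).
exists H, w, k; split=> // v vC.
(* When nothing can be added, [T] is closed under adjacency: vertices of [H] have only leaves as
   neighbours outside [H], and a leaf hanging on [H] has no other neighbour. Connectivity spreads
   [T] over [C]. *)
pose T x := (x \in H) || leaf e x && [exists p in H, e x p].
have clT x y : x \in C -> T x -> e x y -> T y.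
  move=> xC Tx exy; have yC := clC xC exy; rewrite /T; have [//|yH /=] := boolP (y \in H).
  have xH : x \in H.
    case/orP: Tx => // /andP[lx /exists_inP[p pH exp]].
    by rewrite (leaf_nbr lx exy exp) in pH; rewrite pH in yH.
  apply/andP; split; last by apply/exists_inP; exists x; rewrite // e_sym.
  move: maxH; rewrite negb_exists => /forallP/(_ x); rewrite negb_exists => /forallP/(_ y).
  by rewrite xH yC yH exy negbK.
have [r rH] := set0Pn _ H0.
have /connectP[s ps def_v] := conC (subsetP HC r rH) vC.
have : T v.
  have : T r by rewrite /T rH.
  have : r \in C by exact: subsetP HC r rH.
  elim: s r ps def_v {rH} => [|y s IHs] x /=; first by move=> _ ->.
  case/andP => exy ps def_v xC Tx; apply: (IHs y ps def_v (clC xC exy)).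
  exact: clT Tx exy.
by case/orP => [|/andP[_ /exists_inP[p pH evp]]]; [left|right; exists p].
Qed.

Lemma vcoverS S H H' : H \subset H' -> vcover e H' S -> vcover e H S.
Proof.
move=> /subsetP sH /vcoverP cS; apply/vcoverP => x y xH yH; apply: cS; exact: sH.
Qed.

Lemma max_cond_attained (P : nat -> bool) n : (exists m : 'I_n, P m) ->
  P (\max_(m < n | P m) m).
Proof.
move=> [m Pm]; have := @eq_bigmax_cond _ (fun m : 'I_n => P m) (@nat_of_ord n).
by case=> [|i Pi ->] //; apply/card_gt0P; exists m.
Qed.

Section Bipartite.
Variable A : {set V}.
Hypothesis colA : two_colored e C A.

(** The rigidity of minimum covers is the point: if each of them is one of the two sides on [H],
    then a factor [x_a x_b] from opposite sides makes all of them heavier. *)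
Definition tight H w k :=
  [/\ wt (C :&: A) w = k, wt (C :\: A) w = k &
   forall S, vcover e H S -> k <= wt S w /\
     (wt S w = k -> exists b : bool, forall v, v \in H -> (v \in S) = (v \in A) (+) b)].

Lemma tight_step H w k p z : H \subset C -> tight H w k -> p \in H -> z \in C ->
  z \notin H -> e p z -> tight (z |: H) (fun v => w v + ((z == v) + (p == v))) k.+1.
Proof.
move=> HC [wA wA' cov] pH zC zH epz; have pC := subsetP HC p pH.
have := colA pC zC epz; have wtE S : wt S (fun v => w v + ((z == v) + (p == v)))
    = wt S w + ((z \in S) + (p \in S)) by rewrite !wtD !wt_pred1.
move=> neq; split.
- by rewrite wtE wA !inE pC zC; move: neq; case: (p \in A); case: (z \in A); rewrite ?addn1.
- by rewrite wtE wA' !inE pC zC; move: neq; case: (p \in A); case: (z \in A); rewrite ?addn1.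
move=> S cS; rewrite wtE.
have /orP zp : (z \in S) || (p \in S).
  by apply: (vcoverP _ _ _ cS); rewrite ?setU11 ?setU1r // e_sym.
have [leS eqS] := cov S (vcoverS (subsetUr _ _) cS); split.
  by rewrite -addn1 leq_add //; case: zp => ->; rewrite ?addn1.
move=> wk; have [wS szp] : wt S w = k /\ (z \in S) + (p \in S) = 1.
  move: leS wk zp; move: (wt S w) => t; clear.
  by case: (z \in S); case: (p \in S) => // *; (try by case: zp); lia.
have [b eqb] := eqS wS; exists b => v; rewrite inE => /orP[|]; last exact: eqb.
rewrite inE => /eqP->; move: szp neq (eqb p pH).
by case: (z \in S); case: (p \in S) => //; case: (p \in A); case: (z \in A); case: b {eqb}.
Qed.

(** A vertex outside [H] has a neighbour in [H], so a cover that agrees with one side on [H]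
    contains this whole side of [C], hence [a] or [b]. Koenig's theorem turns the cover weights into
    edges. *)
Lemma tight_final H w k : H \subset C -> dominates H -> tight H w k ->
  edge_div e C k w /\ forall a b, a \in C :&: A -> b \in C :\: A ->
    edge_div e C k.+1 (fun v => w v + ((a == v) + (b == v))).
Proof.
move=> HC dom [_ _ cov]; split.
  by apply: (koenig e_sym e_irr colA) => S /(vcoverS HC)/cov[].
move=> a b; rewrite !inE => /andP[aC aA] /andP[bA bC].
apply: (koenig e_sym e_irr colA) => S cS; rewrite !wtD !wt_pred1.
have [leS eqS] := cov S (vcoverS HC cS).
have [ltk|] := ltnP k (wt S w); first exact: leq_trans ltk (leq_addr _ _).
move=> gek; have /eqS[c eqc] : wt S w = k by apply/eqP; rewrite eqn_leq gek.
have inS v : v \in C -> (v \in A) (+) c -> v \in S.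
  move=> vC; have [vH|[p pH evp]] := dom v vC; first by rewrite eqc.
  have pC := subsetP HC p pH.
  have /orP := vcoverP _ _ _ cS v p vC pC evp.
  by case=> //; rewrite eqc //; have := colA vC pC evp; case: (v \in A); case: (p \in A); case: c {eqc}.
case: c inS {eqc} => inS.
  by rewrite (inS b bC) ?(negPf bA) // addn1 addnS ltnS (leq_trans leS) // leq_addr.
by rewrite (inS a aC) ?aA // add1n addnS ltnS (leq_trans leS) // leq_addr.
Qed.

End Bipartite.

(** A weighted analogue of a factor-critical graph: the monomial becomes a product of edges when any
    vertex of [H] is multiplied in or divided out. *)
Definition odd_tight H w k :=
  [/\ wt C w = k.*2.+1,
   forall v, v \in H -> edge_div e C k.+1 (fun u => w u + (v == u)) &
   forall v, v \in H -> exists2 w', (forall u, w u = w' u + (v == u)) & edge_div e C k w'].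

(** Multiplying in the new [z] amounts to dividing [w] by [p] and using the edge [zp] twice;
    dividing it out leaves [w] times [p]. *)
Lemma odd_tight_step H w k p z : H \subset C -> odd_tight H w k -> p \in H -> z \in C ->
  z \notin H -> e p z -> odd_tight (z |: H) (fun v => w v + ((z == v) + (p == v))) k.+1.
Proof.
move=> HC [wC add del] pH zC zH epz; have pC := subsetP HC p pH.
have ezp : e z p by rewrite e_sym.
split.
- by rewrite !wtD !wt_pred1 wC zC pC doubleS addn2.
- move=> v; rewrite !inE => /predU1P[->|vH].
    have [w' def_w dw'] := del p pH.
    have dw1 := edge_divS dw' ezp zC pC (fun u _ => leqnn _).
    apply: (edge_divS dw1 ezp zC pC) => u _; rewrite def_w.
    by move: (w' u) (nat_of_bool (z == u)) (nat_of_bool (p == u)) => a b d; clear; lia.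
  by apply: (edge_divS (add v vH) ezp zC pC) => u _; rewrite addnAC.
- move=> v; rewrite !inE => /predU1P[->|vH].
    by exists (fun u => w u + (p == u)); [move=> u; rewrite addnCA addnC|exact: add].
  have [w' def_w dw'] := del v vH.
  exists (fun u => w' u + ((z == u) + (p == u))); first by move=> u; rewrite def_w addnAC.
  by apply: (edge_divS dw' ezp zC pC).
Qed.

Lemma odd_tight_final H w k : H \subset C -> H != set0 -> dominates H -> odd_tight H w k ->
  edge_div e C k w /\ forall v, v \in C -> edge_div e C k.+1 (fun u => w u + (v == u)).
Proof.
move=> HC /set0Pn[r rH] dom [_ add del]; split.
  have [w' def_w dw'] := del r rH.
  by apply: edge_div_le dw' => // v _; rewrite def_w leq_addr.
move=> v vC; have [/add//|[p pH evp]] := dom v vC.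
have [w' def_w dw'] := del p pH.
apply: (edge_divS dw' evp vC (subsetP HC p pH)) => u _.
by rewrite def_w addnA addnAC.
Qed.

Lemma cycle_leaf_free c : ucycleb e c -> 2 < size c -> leaf_free [set v in c].
Proof. by move=> uc sc x; rewrite inE => /(cycle_not_leaf e_sym uc sc)/negPf->. Qed.

Lemma wt_mem S c : uniq c -> {subset c <= S} -> wt S (fun v => v \in c) = size c.
Proof.
move=> uc cS; rewrite -(card_uniqP uc) -sum1_card /wt [LHS]big_mkcond [RHS]big_mkcond.
by apply: eq_bigr => v _ /=; case: (boolP (v \in c)) => [/cS->|]; case: (v \in S).
Qed.

(** A cover holds at least half of the cycle, and exactly half only if it alternates along it. The
    colouring alternates too, so the two agree or are opposite on the whole cycle. *)
Lemma bipartite_cycle_tight A c : two_colored e C A -> ucycleb e c -> all (mem C) c ->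
  exists2 k, size c = k.*2 & tight A [set v in c] (fun v => v \in c) k.
Proof.
move=> colA uc aC; have [cyc unc] := andP uc.
have cC v : v \in c -> v \in C by exact: (allP aC).
have half S : vcover e [set v in c] S ->
    size c <= (wt S (fun v => v \in c)).*2 /\
    (size c = (wt S (fun v => v \in c)).*2 ->
      forall v, v \in c -> (next c v \in S) = (v \notin S)).
  move=> cS; apply: cycle_cover => // v vc.
  by apply: (vcoverP _ _ _ cS); rewrite ?inE ?mem_next // next_cycle.
have nextA v : v \in c -> (next c v \in A) = (v \notin A).
  move=> vc; have := colA v (next c v) (cC v vc) _ (next_cycle cyc vc).
  by rewrite cC ?mem_next // => /(_ isT); case: (v \in A); case: (_ \in A).
have wtA (B : {set V}) : (forall v, v \in c -> (v \in B) = (v \in A)) \/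
             (forall v, v \in c -> (v \in B) = (v \notin A)) ->
    size c = (wt B (fun v => v \in c)).*2.
  move=> eqB; have nextB v : v \in c -> (next c v \in B) = (v \notin B).
    move=> vc; have nc : next c v \in c by rewrite mem_next.
    by case: eqB => eqB; rewrite !eqB // nextA.
  rewrite -(@wt_mem setT c unc) => [|v _]; last by rewrite inE.
  rewrite /wt -addnn.
  have -> : \sum_(v in [set: V]) (v \in c) = \sum_(v in c) ((v \in B) + (next c v \in B)).
    rewrite [LHS]big_mkcond [RHS]big_mkcond; apply: eq_bigr => v _; rewrite inE.
    by case: (boolP (v \in c)) => // vc; rewrite nextB //; case: (v \in B).
  have -> : \sum_(v in B) (v \in c) = \sum_(v in c) (v \in B).
    rewrite [LHS]big_mkcond [RHS]big_mkcond; apply: eq_bigr => v _ /=.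
    by case: (v \in B); case: (v \in c).
  rewrite big_split; congr (_ + _).
  rewrite [RHS](reindex_inj (can_inj (prev_next unc))) /=.
  by apply: eq_bigl => v; rewrite mem_next.
exists (wt (C :&: A) (fun v => v \in c)).
  by apply: wtA; left=> v /cC vC; rewrite inE vC.
split=> //.
  apply: double_inj; rewrite -wtA; last by right=> v /cC vC; rewrite !inE vC andbT.
  by apply: wtA; left=> v /cC vC; rewrite inE vC.
move=> S cS; have [le eq] := half S cS.
have szA : size c = (wt (C :&: A) (fun v => v \in c)).*2.
  by apply: wtA; left=> v /cC vC; rewrite inE vC.
split; first by rewrite -leq_double -szA.
move=> eqS; have {}eq := eq _; rewrite szA eqS in eq; have {}eq := eq erefl.
have cst : {in c &, forall x y, (x \in S) (+) (x \in A) = (y \in S) (+) (y \in A)}.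
  apply: (cycle_const unc) => v vc; rewrite eq // nextA //.
  by case: (v \in S); case: (v \in A).
case: (pickP (mem c)) => [r /= rc|c0]; last by exists false => v; rewrite inE => vc; have := c0 v; rewrite /= vc.
exists ((r \in S) (+) (r \in A)) => v; rewrite inE => vc.
by rewrite (cst r v rc vc); case: (v \in S); case: (v \in A).
Qed.

(** Cutting the cycle at [v] leaves a path on an even number of vertices, which is perfectly
    matched; so is this path with [v] attached at both ends. *)
Lemma odd_cycle_tight c : ucycleb e c -> all (mem C) c -> odd (size c) ->
  odd_tight [set v in c] (fun v => v \in c) (size c)./2.
Proof.
move=> uc cC oddc; have [cyc unc] := andP uc.
have cut v : v \in c -> exists s, [/\ ucycleb e (v :: s), size s = (size c)./2.*2,
    all (mem C) (v :: s) & forall u, (u \in c) = count_mem u s + (v == u) :> nat].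
  move=> vc; have [s [ucs ps sc]] := ucycle_rot uc vc; exists s; split=> //.
  - by apply: succn_inj; rewrite -sc -[in LHS](odd_double_half (size c)) oddc.
  - by rewrite -(perm_all _ ps).
  - by move=> u; rewrite -count_uniq_mem // (permP ps) /= addnC.
split.
- rewrite wt_mem //; first by rewrite -[in LHS](odd_double_half (size c)) oddc.
  exact/allP.
- move=> v; rewrite inE => /cut[s [/andP[cs us] ss /= /andP[vC sC] cnt]].
  apply: (edge_div_le (k' := (size c)./2.+1) (w' := fun u => count_mem u (v :: rcons s v))) => //.
    by move=> u _; rewrite cnt /= -cats1 count_cat /= addn0 addnCA addnA addnC.
  apply: sorted_edge_div => //; first by rewrite /= size_rcons ss doubleS.
  by rewrite /= all_rcons /= vC.
- move=> v; rewrite inE => /cut[s [/andP[cs us] ss /= /andP[vC sC] cnt]].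
  exists (fun u => count_mem u s); first exact: cnt.
  apply: sorted_edge_div => //.
  by move: cs; rewrite /= rcons_path => /andP[/path_sorted].
Qed.

(** The growth starts from a longest cycle, a longest odd cycle or, in a tree, one vertex, a nonleaf
    if there is one. The clause on leaves lets every leaf edge be charged to a leaf outside [H]. *)
Lemma component_core : exists H A w k,
  [/\ H \subset C, k + comp_k e C = #|H|,
    forall x y, x \in H -> leaf e x -> e x y -> leaf e y /\ y \notin H &
    if bipartite e C then
      [/\ two_colored e C A, wt (C :&: A) w = k, wt (C :\: A) w = k, edge_div e C k w &
        forall a b, a \in C :&: A -> b \in C :\: A ->
          edge_div e C k.+1 (fun v => w v + ((a == v) + (b == v)))]
    else
      [/\ wt C w = k.*2.+1, edge_div e C k w &
        forall v, v \in C -> edge_div e C k.+1 (fun u => w u + (v == u))]].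
Proof.
have leafP H : H \subset C -> leaf_free H -> forall x y, x \in H -> leaf e x -> e x y ->
    leaf e y /\ y \notin H.
  move=> HC lfH x y xH lx exy; have [-> lfC] := lfH x xH lx; split.
    by apply: lfC; apply: clC exy; exact: (subsetP HC).
  by rewrite inE; apply: contraTneq exy => ->; rewrite e_irr.
have cycP m : has_cycle e C m -> exists c, [/\ ucycleb e c, size c = m, 2 < m & all (mem C) c].
  by case/andP => lt2 /existsP[c /andP[uc aC]]; exists c; rewrite size_tuple.
have [bip|nbip] := boolP (bipartite e C).
  have /bipartiteP[A colA] := bip.
  have [H0 [w0 [k0 [HC H0n kc lf tg]]]] : exists H w k,
      [/\ H \subset C, H != set0, k + comp_k e C = #|H|, leaf_free H & tight A H w k].
    rewrite /comp_k bip; have [acy|] := boolP (acyclic e C).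
      have [r rC lfr] : exists2 r, r \in C & leaf_free [set r].
        have [/exists_inP[r rC nl]|] := boolP [exists r in C, ~~ leaf e r].
          by exists r => // x /set1P-> lr; rewrite lr in nl.
        rewrite negb_exists_in => /forall_inP al; have [r rC] := set0Pn _ C_neq0.
        exists r => // x /set1P-> _; split=> // y /al; by rewrite negbK.
      exists [set r], (fun=> 0), 0; split=> //.
      - by rewrite sub1set.
      - by apply/set0Pn; exists r; rewrite set11.
      - by rewrite cards1.
      - split=> [||S _]; rewrite /wt ?big1 //; split=> // _.
        exists ((r \in S) (+) (r \in A)) => v /set1P->.
        by case: (r \in S); case: (r \in A).
    rewrite negb_forall => /existsP[m]; rewrite negbK => hm.
    have := @max_cond_attained (has_cycle e C) _ (ex_intro _ m hm).
    rewrite -/(max_cycle e C) => /cycP[c [uc sc lt2 aC]].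
    have [k sk tg] := bipartite_cycle_tight colA uc aC.
    exists [set v in c], (fun v => v \in c), k; split=> //.
    - by apply/subsetP => v; rewrite inE => /(allP aC).
    - by apply/set0Pn; case: c sc {uc aC tg sk} => [|v c] sc; [rewrite -sc in lt2|exists v; rewrite inE mem_head].
    - by rewrite -sc sk doubleK addnn -sk cardsE (card_uniqP (andP uc).2).
    - by apply: cycle_leaf_free => //; rewrite sc.
  have [H [w [k [HC' kc' lf' dom tg']]]] :=
    grow_core (tight_step colA) HC H0n kc lf tg.
  have [dk dk1] := tight_final colA HC' dom tg'; have [wA wA' _] := tg'.
  by exists H, A, w, k; split=> //; exact: leafP.
have := @max_cond_attained (fun m => has_cycle e C m && odd m) _
  (odd_cycle_exists e_sym e_irr clC conC nbip).
rewrite -/(max_odd_cycle e C) => /andP[/cycP[c [uc sc lt2 aC]] oddm].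
have HC : [set v in c] \subset C by apply/subsetP => v; rewrite inE => /(allP aC).
have H0n : [set v in c] != set0.
  by apply/set0Pn; case: c sc {uc aC HC} => [|v c] sc; [rewrite -sc in lt2|exists v; rewrite inE mem_head].
have kc : (size c)./2 + comp_k e C = #|[set v in c]|.
  rewrite /comp_k (negPf nbip) -sc cardsE (card_uniqP (andP uc).2).
  by rewrite -sc in oddm; rewrite -[in RHS](odd_double_half (size c)) /= uphalf_half oddm -addnn addnCA.
have lf : leaf_free [set v in c] by apply: cycle_leaf_free => //; rewrite sc.
rewrite -sc in oddm.
have [H [w [k [HC' kc' lf' dom tg']]]] :=
  grow_core odd_tight_step HC H0n kc lf (odd_cycle_tight uc aC oddm).
have Hn : H != set0.
  by apply: contraNneq H0n => H0; move: kc'; rewrite H0 cards0 => /eqP; rewrite addn_eq0 /comp_k (negPf nbip) -sc /= andbC; case: (size c) oddm.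
have [dk dk1] := odd_tight_final HC' Hn dom tg'; have [wC _ _] := tg'.
by exists H, set0, w, k; split=> //; exact: leafP.
Qed.

End ComponentCore.

(** * Assembling the components *)

Section Components.
Variables (V : finType) (e : rel V).
Hypotheses (e_sym : ssrbool.symmetric e) (e_irr : irreflexive e).
Implicit Types (C S H A : {set V}) (w : V -> nat) (t : seq V).

Definition component x : {set V} := [set y in [set: V] | connect e x y].

Lemma in_component x y : (y \in component x) = connect e x y.
Proof. by rewrite !inE. Qed.

Lemma component_refl x : x \in component x.
Proof. by rewrite in_component connect0. Qed.

Lemma component_in x : component x \in components e.
Proof. by apply/imsetP; exists x. Qed.

Let connect_esym := sym_connect_sym e_sym.

Lemma component_eq C x : C \in components e -> x \in C -> component x = C.
Proof.
case/imsetP => y _ ->; rewrite -/(component y) in_component => yx.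
by apply/setP => z; rewrite !in_component (same_connect connect_esym yx).
Qed.

Lemma components_closed C x y : C \in components e -> x \in C -> e x y -> y \in C.
Proof. by move=> CC xC /connect1; rewrite -in_component (component_eq CC xC). Qed.

Lemma components_connect C x y : C \in components e -> x \in C -> y \in C -> connect e x y.
Proof. by move=> CC xC; rewrite -in_component (component_eq CC xC). Qed.

Lemma components_neq0 C : C \in components e -> C != set0.
Proof. by case/imsetP => x _ ->; apply/set0Pn; exists x; exact: component_refl. Qed.

Lemma sum_components1 x (F : {set V} -> nat) :
  \sum_(C in components e) (x \in C) * F C = F (component x).
Proof.
rewrite (bigD1 (component x)) ?component_in //= component_refl mul1n big1 ?addn0 //.
move=> C /andP[CC neq]; case: (boolP (x \in C)) => // /(component_eq CC) eqC.
by rewrite -eqC eqxx in neq.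
Qed.

Lemma sum_mem_components x : \sum_(C in components e) (x \in C) = 1.
Proof.
by rewrite -[RHS](sum_components1 x (fun=> 1)); apply: eq_bigr => C _; rewrite muln1.
Qed.

Lemma edge_div_split m w : edge_div e setT m w ->
  exists2 k : {set V} -> nat, \sum_(C in components e) k C = m &
    forall C, C \in components e -> edge_div e C (k C) w.
Proof.
move=> [E [sE aE dE]].
exists (fun C => size [seq p <- E | p.1 \in C]) => [|C CC].
  rewrite -sE -sum1_size; under eq_bigr do rewrite -sum1_size big_filter big_mkcond.
  rewrite exchange_big; apply: eq_bigr => p _ /=.
  by rewrite -[RHS](sum_mem_components p.1); apply: eq_bigr => C _; case: (_ \in C).
exists [seq p <- E | p.1 \in C]; split=> //.
  apply/allP => p; rewrite mem_filter => /andP[pC /(allP aE)/and3P[ep _ _]].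
  by rewrite ep pC (components_closed CC pC ep).
move=> v _; apply: leq_trans (dE v (in_setT v)).
rewrite /dg big_filter big_mkcond; apply: leq_sum => p _.
by case: ifP.
Qed.

Lemma edge_divU C C' k k' w : [disjoint C & C'] -> edge_div e C k w -> edge_div e C' k' w ->
  edge_div e (C :|: C') (k + k') w.
Proof.
have dg0 (D : {set V}) E v : all (fun p => [&& e p.1 p.2, p.1 \in D & p.2 \in D]) E -> v \notin D ->
    dg E v = 0.
  move=> /allP aE vD; rewrite /dg big_seq big1 // => p /aE /and3P[_ p1 p2].
  by case: eqP => [p1v|_]; [rewrite p1v (negPf vD) in p1|case: eqP => // p2v; rewrite p2v (negPf vD) in p2].
move=> dis [E [<- aE dE]] [E' [<- aE' dE']]; exists (E ++ E'); split.
- by rewrite size_cat.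
- rewrite all_cat; apply/andP; split.
    by apply: sub_all aE => p /and3P[-> p1 p2]; rewrite !inE p1 p2.
  by apply: sub_all aE' => p /and3P[-> p1 p2]; rewrite !inE p1 p2 !orbT.
move=> v; rewrite dg_cat inE; case: (boolP (v \in C)) => [vC _|vC /= vC'].
  by rewrite (dg0 _ _ v aE') ?addn0 ?dE // (disjointFr dis vC).
by rewrite (dg0 _ _ v aE) // dE'.
Qed.

Lemma edge_div_glue k w : (forall C, C \in components e -> edge_div e C (k C) w) ->
  edge_div e setT (\sum_(C in components e) k C) w.
Proof.
move=> dk; rewrite -big_enum.
have : uniq (enum (components e)) by exact: enum_uniq.
have : {subset enum (components e) <= components e} by move=> C; rewrite mem_enum.
have -> : [set: V] = \bigcup_(C <- enum (components e)) C.
  apply/esym/setP => v; rewrite inE big_enum; apply/bigcupP.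
  by exists (component v); rewrite ?component_in ?component_refl.
elim: (enum _) => [|C cs IH] sub; first by rewrite !big_nil => _; exact: edge_div0.
rewrite /= => /andP[Ccs ucs]; rewrite !big_cons; apply: edge_divU.
- apply/pred0P => v /=; apply/negP => /andP[vC].
  rewrite big_tnth => /bigcupP[i _ vi].
  have ics := mem_tnth i (in_tuple cs).
  have iC : tnth (in_tuple cs) i \in components e by apply: sub; rewrite inE ics orbT.
  move: Ccs; rewrite -(component_eq (sub C (mem_head _ _)) vC) (component_eq iC vi).
  by rewrite ics.
- exact/dk/sub/mem_head.
- by apply: IH => // D Dcs; apply: sub; rewrite inE Dcs orbT.
Qed.

(* Modulo the power [k+1] of its edge ideal, the monomial [w] of a bipartite
   component with sides [A], [B] is annihilated exactly by the [x_a x_b] with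
   [a] in [A], [b] in [B]; in a nonbipartite component it is a socle element. *)
Definition good C A k w : Prop :=
  if bipartite e C then
    [/\ two_colored e C A, wt (C :&: A) w = k, wt (C :\: A) w = k, edge_div e C k w &
      forall a b, a \in C :&: A -> b \in C :\: A ->
        edge_div e C k.+1 (fun v => w v + ((a == v) + (b == v)))]
  else
    [/\ wt C w = k.*2.+1, edge_div e C k w &
      forall v, v \in C -> edge_div e C k.+1 (fun u => w u + (v == u))].

Lemma good_ext C A A' k w w' : {in C, A =i A'} -> {in C, w =1 w'} ->
  good C A k w -> good C A' k w'.
Proof.
move=> eqA eqw; have wtE S : S \subset C -> wt S w = wt S w'.
  by move=> /subsetP sS; apply: eq_bigr => v /sS/eqw.
have dE j f : edge_div e C j (fun v => w v + f v) -> edge_div e C j (fun v => w' v + f v).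
  by apply: edge_div_le => // v /eqw->.
have dE0 j : edge_div e C j w -> edge_div e C j w'.
  by apply: edge_div_le => // v /eqw->.
have AI : C :&: A' = C :&: A.
  by apply/setP => v; rewrite !inE; case: (boolP (v \in C)) => // /eqA->.
have AD : C :\: A' = C :\: A.
  by apply/setP => v; rewrite !inE; case: (boolP (v \in C)) => [/eqA->|]; rewrite ?andbF.
rewrite /good; case: bipartite => [[cA wA wA' dk dk1]|[wC dk dk1]]; split.
- by move=> x y xC yC exy; rewrite -!eqA // cA.
- by rewrite AI -wtE // subsetIl.
- by rewrite AD -wtE // subsetDl.
- exact: dE0.
- by rewrite AI AD => a b aA bA; apply/dE/dk1.
- by rewrite -wtE.
- exact: dE0.
- by move=> v /dk1/dE.
Qed.

Lemma good_edge C A k w x y : e x y -> x \in C -> y \in C ->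
  good C A k w -> good C A k.+1 (fun v => w v + ((x == v) + (y == v))).
Proof.
move=> exy xC yC; rewrite /good; case: bipartite => [[cA wA wA' dk dk1]|[wC dk dk1]].
  have := cA x y xC yC exy => nA; split=> //.
  - by rewrite !wtD !wt_pred1 wA !inE xC yC; move: nA; case: (x \in A); case: (y \in A); rewrite ?addn1.
  - by rewrite !wtD !wt_pred1 wA' !inE xC yC; move: nA; case: (x \in A); case: (y \in A); rewrite ?addn1.
  - exact: (edge_divS dk exy xC yC).
  - by move=> a b aA bA; apply: (edge_divS (dk1 a b aA bA) exy xC yC) => v _; rewrite addnAC.
split.
- by rewrite !wtD !wt_pred1 wC xC yC doubleS addn2.
- exact: (edge_divS dk exy xC yC).
- by move=> v vC; apply: (edge_divS (dk1 v vC) exy xC yC) => u _; rewrite addnAC.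
Qed.

(** The join, over the bipartite components [C], of two disjoint simplices on [C :&: A] and
    [C :\: A]; faces are lists, with repetitions allowed. *)
Definition face A t : bool :=
  all (fun x => bipartite e (component x) &&
    all (fun y => connect e x y ==> ((x \in A) == (y \in A))) t) t.

Lemma wt_count0 S t : {in t, forall x, x \notin S} -> wt S (fun v => count_mem v t) = 0.
Proof.
move=> tS; rewrite /wt big1 // => v vS; apply/count_memPn.
by apply: contraTN vS => /tS.
Qed.

(** A face misses one side of each bipartite component, and this side is a cover of weight [k C]; in
    a nonbipartite component degree [2k+1] leaves room for only [k] edges. A nonface contains an
    opposite pair or a vertex of a nonbipartite component, which gains one edge. *)
Lemma good_face A k w t : (forall C, C \in components e -> good C A (k C) w) ->
  edge_div e setT (\sum_(C in components e) k C).+1 (fun v => w v + count_mem v t)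
  <-> ~~ face A t.
Proof.
move=> gk; split=> [/edge_div_split[k' sumk' dk']|].
  apply/negP => ft.
  suff : \sum_(C in components e) k' C <= \sum_(C in components e) k C by rewrite sumk' ltnn.
  apply: leq_sum => C CC; have := gk C CC; rewrite /good; case: ifP => [_|nb].
    move=> [cA wA wA' _ _].
    have [tA|] := boolP (has (fun x => (x \in C) && (x \in A)) t).
      rewrite -wA' setDE -[k' C]mul1n.
      apply: (leq_trans (edge_div_wt (d := 1) (S := ~: A) _ (dk' C CC))).
        by move=> x y xC yC /(cA x y xC yC); rewrite !inE; case: (x \in A); case: (y \in A).
      rewrite wtD [X in _ + X]wt_count0 ?addn0 // => y yt; rewrite !inE.
      have /hasP[x xt /andP[xC xA]] := tA.
      apply/negP => /andP[yC]; have /andP[_ /allP/(_ y yt)] := allP ft x xt.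
      by rewrite (components_connect CC xC yC) xA /= => /eqP<-.
    move=> /hasPn tA; rewrite -wA -[k' C]mul1n.
    apply: (leq_trans (edge_div_wt (d := 1) (S := A) _ (dk' C CC))).
      by move=> x y xC yC /(cA x y xC yC); case: (x \in A); case: (y \in A).
    by rewrite wtD [X in _ + X]wt_count0 ?addn0 // => y /tA; rewrite !inE.
  move=> [wC _ _]; suff : 2 * k' C <= wt C w.
    by rewrite wC; move: (k C) (k' C) => p q; clear; lia.
  apply: leq_trans (edge_div_wt (d := 2) (S := setT) _ (dk' C CC)) _.
    by move=> x y; rewrite !inE.
  rewrite setIT wtD wt_count0 ?addn0 // => x xt; apply/negP => xC.
  by have /andP[] := allP ft x xt; rewrite (component_eq CC xC) nb.
move=> /allPn[x xt]; rewrite negb_and => nface.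
have CC := component_in x; have xC := component_refl x.
suff dk1 : edge_div e (component x) (k (component x)).+1 (fun v => w v + count_mem v t).
  have -> : (\sum_(C in components e) k C).+1 =
      \sum_(C in components e) (k C + (x \in C)).
    by rewrite big_split /= sum_mem_components addn1.
  apply: edge_div_glue => C CC'; have [xC'|xC'] := boolP (x \in C).
    by rewrite -(component_eq CC' xC') addn1.
  rewrite addn0; have dk : edge_div e C (k C) w.
    by have := gk C CC'; rewrite /good; case: ifP => _ [].
  by apply: edge_div_le dk => // v _; rewrite leq_addr.
have count1 v z : z \in t -> (z == v) <= count_mem v t.
  by move=> zt; case: eqP => // <-; rewrite -has_count has_pred1.
have := gk _ CC; rewrite /good; case: (boolP (bipartite e _)) nface => /= [bip nface|nb _].
  move=> [cA _ _ _ dk1]; case/allPn: nface => y yt.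
  rewrite negb_imply => /andP[xy nA]; have yC : y \in component x by rewrite in_component.
  have cnt v : (x == v) + (y == v) <= count_mem v t.
    case: (eqVneq x v) => [xv|_]; last exact: count1.
    case: (eqVneq y v) => [yv|_]; first by rewrite xv yv eqxx in nA.
    by have := count1 v x xt; rewrite xv eqxx.
  have [xA|xA] := boolP (x \in A).
    apply: edge_div_le (dk1 x y _ _) => //; first by move=> v _; rewrite leq_add2l.
      by rewrite inE xC.
    by rewrite inE yC; move: nA; rewrite xA; case: (y \in A).
  apply: edge_div_le (dk1 y x _ _) => //; first by move=> v _; rewrite leq_add2l addnC.
    by rewrite inE yC; move: nA; rewrite (negPf xA); case: (y \in A).
  by rewrite inE xC xA.
move=> [_ _ dk1]; apply: edge_div_le (dk1 x xC) => // v _.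
by rewrite leq_add2l count1.
Qed.

Lemma global_core : (forall x, exists y, e x y) ->
  exists A N, [/\ forall C, C \in components e -> bipartite e C -> two_colored e C A,
    N + \sum_(C in components e) comp_k e C + #|leaf_edges e| <= #|V| &
    forall m, N < m -> exists w, forall t,
      edge_div e setT m (fun v => w v + count_mem v t) <-> ~~ face A t].
Proof.
move=> noiso.
have core C : exists H A w k, C \in components e ->
    [/\ H \subset C, k + comp_k e C = #|H|,
      forall x y, x \in H -> leaf e x -> e x y -> leaf e y /\ y \notin H & good C A k w].
  have [CC|_] := boolP (C \in components e); last by exists C, C, (fun=> 0), 0.
  have [||H [A [w [k core]]]] := component_core e_sym e_irr (C := C) _ _ (components_neq0 CC).
  - by move=> x y; exact: components_closed.
  - by move=> x y; exact: components_connect.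
  by exists H, A, w, k.
have [H {}core] := fin_all_exists core.
have [A0 {}core] := fin_all_exists core.
have [w0 {}core] := fin_all_exists core.
have [k0 {}core] := fin_all_exists core.
pose A := [set v | v \in A0 (component v)].
pose w v := w0 (component v) v.
pose HH := [set v | v \in H (component v)].
have gk C : C \in components e -> good C A (k0 C) w.
  move=> CC; have [_ _ _] := core C CC; apply: good_ext => v vC.
    by rewrite inE (component_eq CC vC).
  by rewrite /w (component_eq CC vC).
(* Multiplying by a fixed edge raises the exponent of its component by one and preserves [good], so
   all larger sums are reached. *)
have gkj j : (exists x : V, true) -> exists k w,
    (\sum_(C in components e) k C = \sum_(C in components e) k0 C + j) /\
    forall C, C \in components e -> good C A (k C) w.
  move=> [x _]; have [y exy] := noiso x; elim: j => [|j [k [w' [sk gkw]]]].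
    by exists k0, w; rewrite addn0.
  exists (fun C => (x \in C) + k C), (fun v => w' v + ((x == v) + (y == v))); split.
    by rewrite big_split /= sk sum_mem_components add1n addnS.
  move=> C CC; have := gkw C CC; have [xC|xC] := boolP (x \in C).
    exact: good_edge exy xC (components_closed CC xC exy).
  apply: good_ext => // v vC.
  have /negPf-> : x != v by apply: contraNneq xC => ->.
  have /negPf-> : y != v.
    by apply: contraNneq xC => yv; apply: (components_closed CC vC); rewrite -yv e_sym.
  by rewrite addn0.
exists A, (\sum_(C in components e) k0 C); split.
- by move=> C CC bip; have := gk C CC; rewrite /good bip => -[].
- have leH : \sum_(C in components e) #|H C| <= #|HH|.
    under eq_bigr do rewrite -sum1_card big_mkcond.
    rewrite exchange_big -sum1_card [X in _ <= X]big_mkcond; apply: leq_sum => v _ /=.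
    rewrite inE -[X in _ <= X](sum_components1 v (fun C => if v \in H C then 1 else 0)).
    apply: leq_sum => C CC; case: ifP => // vH.
    by have [/subsetP/(_ v vH) -> _ _ _] := core C CC.
  (* At a leaf this is its edge, and the default is not taken. Every leaf edge is the image of a
     leaf outside [HH]: if one end is a leaf in [HH], the other end is a leaf outside. *)
  pose f v := [set v; odflt v [pick y | e v y]].
  have fE x y : leaf e x -> e x y -> f x = [set x; y].
    move=> lx exy; rewrite /f; case: pickP => [z exz|/(_ y)]; last by rewrite exy.
    by rewrite (leaf_nbr lx exy exz).
  have leaves x y : e x y -> leaf e x -> [set x; y] \in f @: ~: HH.
    move=> exy lx; have [xH|xH] := boolP (x \in H (component x)); last first.
      by rewrite -(fE x y) //; apply: imset_f; rewrite !inE.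
    have [_ _ /(_ x y xH lx exy)[ly yH] _] := core _ (component_in x).
    rewrite setUC -(fE y x) // 1?e_sym //; apply: imset_f; rewrite !inE.
    by rewrite (component_eq (component_in x)) // in_component connect1.
  have : #|leaf_edges e| <= #|f @: ~: HH|.
    apply/subset_leq_card/subsetP => E.
    rewrite inE => /andP[/imsetP[[x y] + ->] /exists_inP[z]]; rewrite !inE /= => exy.
    by case/orP => /eqP-> lz; [|rewrite setUC]; apply: leaves; rewrite // e_sym.
  have := leq_imset_card f (~: HH); have := cardsC HH.
  have -> : \sum_(C in components e) k0 C + \sum_(C in components e) comp_k e C
      = \sum_(C in components e) #|H C|.
    by rewrite -big_split; apply: eq_bigr => C /core[_ kC _ _]; exact: kC.
  move: leH; move: #|HH| #|~: HH| #|f @: ~: HH| #|leaf_edges e| #|V| (\sum_(C in _) _).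
  by clear; lia.
(* Without vertices there is no edge to multiply by, but then both sides are false because [m] is
   positive. *)
- move=> m ltm; have [x0 _|V0] := pickP (@predT V); last first.
    exists (fun=> 0) => t; have -> : t = [::] by case: t => // x; have := V0 x.
    split=> // -[E [sE _ _]]; case: E sE ltm => [<-|p] //; by have := V0 p.1.
  have [|k [w' [sk gkw]]] := gkj (m.-1 - \sum_(C in components e) k0 C); first by exists x0.
  exists w' => t; rewrite -(good_face t gkw) sk subnKC; last by rewrite -ltnS prednK // (leq_ltn_trans _ ltm).
  by rewrite prednK // (leq_ltn_trans _ ltm).
Qed.

End Components.

(** * Koszul cohomology and regular sequences *)

Import GRing.Theory.

Section Ideals.
Local Open Scope ring_scope.
Variable R : comNzRingType.
Implicit Types (S J : R -> Prop) (s : seq R).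

Definition is_ideal J : Prop :=
  [/\ J 0, forall f g, J f -> J g -> J (f + g) & forall a f, J f -> J (a * f)].

Lemma ideal_sum J (I : Type) (r : seq I) (P : pred I) (F : I -> R) :
  is_ideal J -> (forall i, P i -> J (F i)) -> J (\sum_(i <- r | P i) F i).
Proof. by move=> [J0 JD _] JF; elim/big_rec: _ => // i x Pi Jx; apply: JD => //; exact: JF. Qed.

Lemma idealB J f g : is_ideal J -> J f -> J g -> J (f - g).
Proof. by move=> [_ JD JM] Jf Jg; apply: JD => //; rewrite -mulN1r; exact: JM. Qed.

Lemma ideal_gen_base S f : S f -> ideal_gen S f.
Proof.
by move=> Sf; exists 1, (fun=> 1), (fun=> f); split=> //; rewrite big_ord1 mul1r.
Qed.

Lemma ideal_gen_min S J : is_ideal J -> (forall f, S f -> J f) ->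
  forall f, ideal_gen S f -> J f.
Proof.
move=> iJ SJ f [k [a [g [Sg ->]]]]; apply: ideal_sum => // i _.
by case: iJ => _ _; apply; exact/SJ.
Qed.

Lemma ideal_gen_ideal S : is_ideal (ideal_gen S).
Proof.
split.
- exists 0, (fun=> 0), (fun=> 0); split; first by case.
  by rewrite big_ord0.
- move=> f g [k [a [h [Sh ->]]]] [l [b [h' [Sh' ->]]]].
  exists (k + l), (fun i => match split i with inl j => a j | inr j => b j end),
    (fun i => match split i with inl j => h j | inr j => h' j end); split.
    by move=> i; case: split.
  rewrite big_split_ord; congr (_ + _); apply: eq_bigr => i _.
    by rewrite (unsplitK (inl i)).
  by rewrite (unsplitK (inr i)).
- move=> b f [k [a [h [Sh ->]]]]; exists k, (fun i => b * a i), h; split=> //.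
  by rewrite mulr_sumr; apply: eq_bigr => i _; rewrite mulrA.
Qed.

Lemma ideal_adjoin_cons J f s g :
  ideal_adjoin (ideal_adjoin J [:: f]) s g <-> ideal_adjoin J (f :: s) g.
Proof.
split; apply: ideal_gen_min; try exact: ideal_gen_ideal.
- move=> h [|hs]; last by apply: ideal_gen_base; right; rewrite inE hs orbT.
  apply: ideal_gen_min; first exact: ideal_gen_ideal.
  by move=> k [Jk|]; [|rewrite inE => /eqP->]; apply: ideal_gen_base; [left|right; rewrite mem_head].
- move=> h [Jh|]; first by apply: ideal_gen_base; left; apply: ideal_gen_base; left.
  rewrite inE => /predU1P[->|hs]; apply: ideal_gen_base; last by right.
  by left; apply: ideal_gen_base; right; rewrite mem_head.
Qed.

Lemma ideal_adjoin_nil J g : is_ideal J -> ideal_adjoin J [::] g <-> J g.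
Proof.
move=> iJ; split; last by move=> Jg; apply: ideal_gen_base; left.
by apply: ideal_gen_min => // f [].
Qed.

Lemma ideal_adjoin1 J f g : is_ideal J -> ideal_adjoin J [:: f] g ->
  exists h, J (g - f * h).
Proof.
move=> iJ; have [J0 JD JM] := iJ; move: g; apply: ideal_gen_min.
  split; first by exists 0; rewrite mulr0 subr0.
    by move=> g g' [h Jh] [h' Jh']; exists (h + h'); rewrite mulrDr opprD addrACA; exact: JD.
  by move=> a g [h Jh]; exists (a * h); rewrite mulrCA -mulrBr; exact: JM.
move=> g [Jg|]; first by exists 0; rewrite mulr0 subr0.
by rewrite inE => /eqP->; exists 1; rewrite mulr1 subrr.
Qed.

Lemma regular_cons J f s : is_ideal J -> regular_seq J (f :: s) ->
  (forall g, J (f * g) -> J g) /\ regular_seq (ideal_adjoin J [:: f]) s.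
Proof.
move=> iJ [reg ne1]; split.
  by move=> g Jfg; apply/(ideal_adjoin_nil _ iJ)/(reg 0) => //; exact/ideal_adjoin_nil.
split; last by move/ideal_adjoin_cons.
by move=> i ltis g /ideal_adjoin_cons H; apply/ideal_adjoin_cons/(reg i.+1).
Qed.

End Ideals.

Section Koszul.
Local Open Scope ring_scope.
Variables (R : comNzRingType) (V : finType).
Implicit Types (x y : V -> R) (c b : seq V -> R).

(* The Koszul differential on ordered cochains: arbitrary, not necessarily
   alternating, functions on tuples of indices. *)
Fixpoint kd x c (t : seq V) : R :=
  if t is v :: t' then x v * c t' - kd x (fun s => c (v :: s)) t' else 0.

Lemma eq_kd x c b t : c =1 b -> kd x c t = kd x b t.
Proof. by elim: t c b => //= v t IH c b cb; rewrite cb; congr (_ - _); apply: IH => s. Qed.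

Lemma kdD x c b t : kd x (fun s => c s + b s) t = kd x c t + kd x b t.
Proof.
elim: t c b => [|v t IH] c b /=; first by rewrite addr0.
by rewrite IH; ring.
Qed.

Lemma kdM x a c t : kd x (fun s => a * c s) t = a * kd x c t.
Proof.
elim: t c => [|v t IH] c /=; first by rewrite mulr0.
by rewrite IH; ring.
Qed.

Lemma kdN x c t : kd x (fun s => - c s) t = - kd x c t.
Proof. by rewrite -mulN1r -kdM; apply: eq_kd => s; rewrite mulN1r. Qed.

Lemma kdB x c b t : kd x (fun s => c s - b s) t = kd x c t - kd x b t.
Proof. by rewrite kdD kdN. Qed.

Lemma kd_sum x (I : Type) (r : seq I) (F : I -> seq V -> R) t :
  kd x (fun s => \sum_(i <- r) F i s) t = \sum_(i <- r) kd x (F i) t.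
Proof.
elim: r => [|i r IH].
  rewrite big_nil -[RHS](mul0r (kd x (fun=> 0) t)) -kdM; apply: eq_kd => s.
  by rewrite big_nil mul0r.
rewrite big_cons -IH -kdD; apply: eq_kd => s.
by rewrite big_cons.
Qed.

Lemma kd_anticomm x y c t : kd x (kd y c) t = - kd y (kd x c) t.
Proof.
elim: t c => [|v t IH] c /=; first by rewrite oppr0.
by rewrite !kdB !kdM IH; ring.
Qed.

Lemma kd_kd x c t : kd x (kd x c) t = 0.
Proof.
elim: t c => [|v t IH] c //=.
by rewrite kdB kdM IH; ring.
Qed.

Lemma kd_ideal J x c t k : is_ideal J -> size t = k.+1 ->
  (forall s, size s = k -> J (c s)) -> J (kd x c t).
Proof.
move=> iJ; have [J0 _ JM] := iJ.
elim: t c k => [|v t IH] c k //= [st] Jc; apply: idealB => //; first exact/JM/Jc.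
case: k st Jc => [|k] st Jc; first by case: t st {IH}.
by apply: (IH _ k) => // s ss; apply: Jc => /=; rewrite ss.
Qed.

(* Contraction with [f = \sum_i a_i x_(v_i)] is a homotopy from [f] to [0]. *)
Lemma kd_homotopy x c (k : nat) (a : 'I_k -> R) (v : 'I_k -> V) t :
  kd x (fun s => \sum_i a i * c (v i :: s)) t
  = (\sum_i a i * x (v i)) * c t - \sum_i a i * kd x c (v i :: t).
Proof.
rewrite kd_sum mulr_suml -sumrB; apply: eq_bigr => i _ /=.
by rewrite kdM; ring.
Qed.

(* Vanishing of the [d]-th Koszul cohomology of [R/J]: contraction with the
   first element of the sequence lowers [d]. *)
Lemma koszul_acyclic x J fs c d : is_ideal J ->
  regular_seq_in (ideal_gen (fun f => exists v, f = x v)) J fs ->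
  (d < size fs)%N ->
  (forall t, size t = d.+1 -> J (kd x c t)) ->
  exists b, forall t, size t = d -> J (c t - kd x b t).
Proof.
elim: d fs J c => [|d IH] [|f fs] J c // iJ [Mfs /(regular_cons iJ)[regf regfs]].
all: have [J0 JD JM] := iJ.
all: have [k [a [g [Sg def_f]]]] := Mfs f (mem_head _ _).
all: have [v def_g] := fin_all_exists Sg.
all: have {g Sg def_g} def_f: f = \sum_i a i * x (v i)
  by rewrite def_f; apply: eq_bigr => i _; rewrite def_g.
  move=> _ cocyc; exists (fun=> 0); case=> //= _; rewrite subr0.
  apply: regf; rewrite def_f mulr_suml; apply: ideal_sum => // i _.
  rewrite -mulrA; apply: JM.
  by have /= := cocyc [:: v i] erefl; rewrite subr0.
move=> /= ltds cocyc.
(* Modulo [J], [d b = f c], so [b] is a cocycle modulo [J + (f)] and [b = d b' + f h'] by induction.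
   Applying [d] gives [f c = f d h'], and [f] cancels. *)
pose b := fun s => \sum_i a i * c (v i :: s).
have db t : size t = d.+1 -> J (f * c t - kd x b t).
  move=> st; rewrite kd_homotopy -def_f opprB addrC subrK.
  apply: ideal_sum => // i _; apply: JM.
  by apply: cocyc; rewrite /= st.
have iJ' : is_ideal (ideal_adjoin J [:: f]) by exact: ideal_gen_ideal.
have [||t st|b' Hb'] := IH fs _ b iJ'.
- by split=> // h hfs; apply: Mfs; rewrite inE hfs orbT.
- exact: ltds.
- rewrite -[kd _ _ _](subKr (f * c t)); apply: idealB => //.
    by rewrite mulrC; have [_ _] := iJ'; apply; apply: ideal_gen_base; right; rewrite mem_head.
  by apply: ideal_gen_base; left; apply: db.
have [h Jh] := fin_all_exists
  (fun t : d.-tuple V => ideal_adjoin1 iJ (Hb' t (size_tuple t))).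
(* The choice is made over the finite type of [d]-tuples; the default 0 at other sizes does not
   enter the differential in size [d.+1]. *)
pose h' s := if insub s is Some t then h t else 0.
have Jh' t : size t = d -> J (b t - kd x b' t - f * h' t).
  move=> /eqP st; rewrite /h' insubT; exact: Jh (Tuple st).
exists h' => t st; apply: regf.
have /(kd_ideal x iJ st) : forall s, size s = d -> J (b s - kd x b' s - f * h' s) by exact: Jh'.
rewrite !kdB kd_kd subr0 kdM => Jb.
have := JD _ _ (db t st) Jb.
by rewrite addrA subrK mulrBr.
Qed.
End Koszul.

(** * Monomial ideals *)

Section MonomialIdeals.
Local Open Scope ring_scope.
Variables (K : fieldType) (V : finType).
Local Notation n := #|V|.
Implicit Types (f g : {mpoly K[n]}) (u : 'X_{1..n}) (v : V) (P : 'X_{1..n} -> Prop).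

Definition expo u v : nat := u (enum_rank v).

Definition vmon v : 'X_{1..n} := U_(enum_rank v)%MM.

Lemma expoD u u' v : expo (u + u')%MM v = (expo u v + expo u' v)%N.
Proof. by rewrite /expo mnmDE. Qed.

Lemma expo_vmon v v' : expo (vmon v) v' = (v == v').
Proof. by rewrite /expo mnm1E (inj_eq enum_rank_inj). Qed.

Lemma expo_inj u u' : expo u =1 expo u' -> u = u'.
Proof. by move=> eq; apply/mnmP => i; have := eq (enum_val i); rewrite /expo enum_valK. Qed.

Definition monomial_ideal P f : Prop := forall u, u \in msupp f -> P u.

Lemma monomial_ideal_mul P P' P'' f g :
  (forall u u', P u -> P' u' -> P'' (u + u')%MM) ->
  monomial_ideal P f -> monomial_ideal P' g -> monomial_ideal P'' (f * g).
Proof.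
move=> PP Pf Pg u /msuppM_le /allpairsP[[u1 u2] /= [uf ug ->]].
by apply: PP; [apply: Pf|apply: Pg].
Qed.

Lemma monomial_ideal_ideal P : (forall u u', P u -> P (u' + u)%MM) ->
  is_ideal (monomial_ideal P).
Proof.
move=> upP; split.
- by move=> u; rewrite msupp0.
- by move=> f g Pf Pg u /msuppD_le; rewrite mem_cat => /orP[/Pf|/Pg].
- move=> a f; apply: (monomial_ideal_mul (P := fun=> True)) => // u u' _; exact: upP.
Qed.

Lemma monomial_idealX P u : P u -> monomial_ideal P 'X_[u].
Proof. by move=> Pu u'; rewrite msuppX inE => /eqP->. Qed.

Variable e : rel V.

Lemma edge_div_expo m u u' : edge_div e setT m (expo u) -> edge_div e setT m (expo (u' + u)%MM).
Proof. by apply: edge_div_le => // v _; rewrite expoD leq_addl. Qed.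

Lemma edge_ideal_expP m f : ideal_exp (edge_ideal K e) m f <->
  monomial_ideal (fun u => edge_div e setT m (expo u)) f.
Proof.
split.
  move: f; apply: ideal_gen_min; first by apply: monomial_ideal_ideal => u u'; exact: edge_div_expo.
  move=> f [g [Ig ->]]; elim: m g Ig => [|m IH] g Ig.
    by rewrite big_ord0 => u _; exact: edge_div0.
  rewrite big_ord_recl.
  apply: (monomial_ideal_mul (P := fun u => edge_div e setT 1 (expo u))) (IH _ _) => //.
  - move=> u u' du du'; rewrite -add1n; apply: edge_div_le (edge_divD du du') => // v _.
    by rewrite expoD.
  - move: (Ig ord0); move: (g ord0); apply: ideal_gen_min.
      apply: monomial_ideal_ideal => u u'; exact: (@edge_div_expo 1).
    move=> _ [x [y [exy ->]]]; rewrite -mpolyXD; apply: monomial_idealX.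
    apply: edge_div_le (edge_div1 exy (in_setT x) (in_setT y)) => // v _.
    by rewrite expoD !expo_vmon.
move=> If; rewrite (mpolyE f); have iE := ideal_gen_ideal _ : is_ideal (ideal_exp (edge_ideal K e) m).
rewrite big_seq; apply: ideal_sum => // u /If[E [sE aE dE]].
rewrite -mul_mpolyC; have [_ _ IM] := iE; apply: (IM _ _).
pose d := (\sum_(p <- E) (vmon p.1 + vmon p.2))%MM.
have dE' v : expo d v = dg E v.
  rewrite /expo mnm_sumE; apply: eq_bigr => p _.
  by rewrite -[LHS]/(expo _ _) expoD !expo_vmon.
have -> : u = (u - d + d)%MM.
  rewrite submK //; apply/mnm_lepP => i.
  by have := dE (enum_val i) (in_setT _); rewrite -dE' /expo enum_valK.
rewrite mpolyXD; apply: IM; apply: ideal_gen_base.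
subst m; exists (fun i => 'X_(enum_rank (tnth (in_tuple E) i).1) * 'X_(enum_rank (tnth (in_tuple E) i).2)).
split=> [i|].
  apply: ideal_gen_base; exists (tnth (in_tuple E) i).1, (tnth (in_tuple E) i).2; split=> //.
  by have /and3P[] := allP aE _ (mem_tnth i (in_tuple E)).
rewrite /d (big_tnth _ _ E) (big_morph _ (@mpolyXD n K) (@mpolyX0 n K)).
by apply: eq_bigr => i _; rewrite mpolyXD.
Qed.

Lemma mcoeffXUM v g u :
  ('X_(enum_rank v) * g)@_u = if (0 < expo u v)%N then g@_(u - vmon v)%MM else 0.
Proof.
case: ifP => [uv|uv].
  have {1}-> : u = (vmon v + (u - vmon v))%MM by rewrite addmC submK // lep1mP -lt0n.
  by rewrite mulrC mcoeffMX.
apply/eqP; rewrite mcoeff_eq0; apply/negP => /msuppM_le /allpairsP[[u1 u2] /= [+ _ def_u]].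
rewrite msuppX inE => /eqP eu1.
by move: uv; rewrite def_u eu1 expoD expo_vmon eqxx.
Qed.

End MonomialIdeals.

(** * Cover numbers and the pivot variable *)

Lemma lex_lt1 n d a a' b b' c c' : a < a' -> b <= n -> c <= d ->
  (a * n.+1 + b) * d.+1 + c < (a' * n.+1 + b') * d.+1 + c'.
Proof.
move=> lta leb lec; apply: (@leq_trans (a.+1 * n.+1 * d.+1)).
  by move: leb lec; clear; nia.
by apply: leq_trans (leq_addr _ _); rewrite leq_mul2r (leq_trans _ (leq_addr _ _)) ?orbT // leq_mul2r lta orbT.
Qed.

Lemma lex_lt2 d b b' c c' : b < b' -> c <= d -> b * d.+1 + c < b' * d.+1 + c'.
Proof.
move=> ltb lec; apply: (@leq_trans (b.+1 * d.+1)); first by rewrite mulSn addnC ltn_add2r.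
by apply: leq_trans (leq_addr _ _); rewrite leq_mul2r ltb orbT.
Qed.

Section Pivot.
Variables (V : finType) (e : rel V).
Hypotheses (e_sym : ssrbool.symmetric e) (e_irr : irreflexive e).
Variables (C : {set V}) (x0 : V).
Implicit Types (w : V -> nat) (S : {set V}).

(* By Koenig's theorem, the order of the monomial [w] with respect to the edge
   ideal of the bipartite component [C]. *)
Definition cover_num w : nat :=
  wt (C :&: [arg min_(S < [set: V] | vcover e C S) wt (C :&: S) w]) w.

Lemma vcoverT : vcover e C setT.
Proof. by apply/vcoverP => x y; rewrite !inE. Qed.

Lemma cover_num_le w S : vcover e C S -> cover_num w <= wt (C :&: S) w.
Proof.
by rewrite /cover_num; case: (arg_minnP (fun S => wt (C :&: S) w) vcoverT) => S' _; apply.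
Qed.

Lemma cover_num_attained w : exists2 S, vcover e C S & wt (C :&: S) w = cover_num w.
Proof.
rewrite /cover_num; case: (arg_minnP (fun S => wt (C :&: S) w) vcoverT) => S' cS' _.
by exists S'.
Qed.

Lemma wt_mono S w w' : {in S, forall v, w v <= w' v} -> wt S w <= wt S w'.
Proof. by move=> le; apply: leq_sum. Qed.

Lemma cover_num_mono w w' : {in C, forall v, w v <= w' v} -> cover_num w <= cover_num w'.
Proof.
move=> le; have [S cS <-] := cover_num_attained w'.
apply: leq_trans (cover_num_le w cS) _; apply: wt_mono => v.
by rewrite inE => /andP[/le].
Qed.

Lemma cover_num_ext w w' : {in C, w =1 w'} -> cover_num w = cover_num w'.
Proof.
by move=> eq; apply/eqP; rewrite eqn_leq !cover_num_mono // => v /eq->.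
Qed.

(** These are the variables of [C] by which [w] can be multiplied without changing its cover
    number. *)
Definition missed w q : bool :=
  (q \in C) && [exists S, [&& vcover e C S, q \notin S & wt (C :&: S) w == cover_num w]].

Lemma missed_ext w w' : {in C, w =1 w'} -> missed w =1 missed w'.
Proof.
move=> eq q; congr (_ && _); apply: eq_existsb => S.
by rewrite (cover_num_ext eq) /wt (eq_bigr w') // => v; rewrite inE => /andP[/eq].
Qed.

Definition pivot w : V :=
  odflt x0 [pick q | missed w q && [forall q', missed w q' ==> (enum_rank q <= enum_rank q')]].

Lemma pivot_ext w w' : {in C, w =1 w'} -> pivot w = pivot w'.
Proof.
move=> eq; rewrite /pivot; congr odflt; apply: eq_pick => q.
rewrite (missed_ext eq); congr (_ && _); apply: eq_forallb => q'.
by rewrite (missed_ext eq).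
Qed.

Hypotheses (bipC : bipartite e C) (edgeC : exists x y, [/\ x \in C, y \in C & e x y]).

(** If a minimum cover contains all of [C], one colour class weighs no more, so it is also a minimum
    cover, and it misses an end of an edge. *)
Lemma missed_exists w : exists q, missed w q.
Proof.
have [S cS wS] := cover_num_attained w.
have [/existsP[q /andP[qC qS]]|] := boolP [exists q, (q \in C) && (q \notin S)].
  by exists q; rewrite /missed qC; apply/existsP; exists S; rewrite cS qS wS eqxx.
rewrite negb_exists => /forallP CS.
have {CS} CS : C :&: S = C.
  by apply/setIidPl/subsetP => q qC; have := CS q; rewrite qC /= negbK.
have /bipartiteP[A colA] := bipC.
have [cA wA] : vcover e C A /\ wt (C :&: A) w = cover_num w.
  have cA : vcover e C A.
    by apply/vcoverP => x y xC yC /(colA x y xC yC); case: (x \in A); case: (y \in A).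
  split=> //; apply/eqP; rewrite eqn_leq cover_num_le // andbT -wS CS.
  by rewrite wtS // subsetIl.
have [x [y [xC yC exy]]] := edgeC; have := colA x y xC yC exy.
case: (boolP (x \in A)) => [xA yA|xA _].
  exists y; rewrite /missed yC; apply/existsP; exists A; rewrite cA wA eqxx.
  by rewrite andbT; case: (y \in A) yA.
by exists x; rewrite /missed xC; apply/existsP; exists A; rewrite cA wA eqxx xA.
Qed.

Lemma pivotP w : missed w (pivot w) /\
  forall q, missed w q -> enum_rank (pivot w) <= enum_rank q.
Proof.
rewrite /pivot; case: pickP => [q /andP[mq /forallP min]|nopick].
  by split=> // q' mq'; have := min q'; rewrite mq'.
have [q0 mq0] := missed_exists w.
have [q mq min] := arg_minnP (fun q => val (enum_rank q)) mq0.
have := nopick q; rewrite mq /= => /negbT/negP[]; apply/forallP => q'.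
by apply/implyP; exact: min.
Qed.

Lemma pivot_in w : pivot w \in C.
Proof. by have [/andP[]] := pivotP w. Qed.

Lemma wtDs S w q : wt S (fun v => w v + (q == v)) = wt S w + (q \in S).
Proof. by rewrite wtD wt_pred1. Qed.

Lemma cover_num_pivot w w' : (forall v, w' v = w v + (pivot w == v)) ->
  cover_num w' = cover_num w /\ missed w' (pivot w).
Proof.
move=> def_w'; have [/andP[pC /existsP[S /and3P[cS pS /eqP wS]]] _] := pivotP w.
have wS' : wt (C :&: S) w' = cover_num w.
  rewrite -wS -[RHS]addn0 /wt (eq_bigr _ (fun v _ => def_w' v)) -/(wt _ _) wtDs.
  by rewrite inE (negPf pS) andbF.
have eqn : cover_num w' = cover_num w.
  apply/eqP; rewrite eqn_leq -{1}wS' cover_num_le // cover_num_mono // => v _.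
  by rewrite def_w' leq_addr.
by split=> //; rewrite /missed pC; apply/existsP; exists S; rewrite cS pS wS' eqn eqxx.
Qed.

(* Lexicographic: larger cover number first, then larger pivot, then smaller
   exponent of the pivot; [D] bounds the total degree. *)
Definition pivot_measure D w : nat :=
  ((D - cover_num w) * #|V|.+1 + (#|V| - enum_rank (pivot w))) * D.+1 + w (pivot w).

(** The pivot does not change the cover number of [w], so that of [w0] is at most as large. If they
    agree, the pivot of [w] is missed for [w0] too, so the pivot of [w0] comes no later. If the
    pivots agree, its exponent in [w] is smaller by one. *)
Lemma pivot_measure_lt D w w0 v : v \in C -> v != pivot w -> wt setT w0 <= D ->
  (forall x, w x + (pivot w == x) = w0 x + (v == x)) ->
  pivot_measure D w < pivot_measure D w0.
Proof.
move=> vC npv degD eqw.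
have degw : wt setT w <= D.
  suff <- : wt setT w0 = wt setT w by [].
  apply: (@addIn 1); have {1}-> : 1 = (v \in [set: V]) by rewrite inE.
  have -> : 1 = (pivot w \in [set: V]) by rewrite inE.
  by rewrite -!wtDs; apply: eq_bigr.
have ltpt S (w1 : V -> nat) x : wt setT w1 <= D -> w1 x <= D.
  by apply: leq_trans; rewrite /wt (bigD1 x) ?inE //= leq_addr.
have cov_le w1 : wt setT w1 <= D -> cover_num w1 <= D.
  apply: leq_trans; apply: leq_trans (cover_num_le w1 vcoverT) _.
  by rewrite wtS // subsetT.
have [eqn mp] := cover_num_pivot (w' := fun x => w0 x + (v == x)) (fun x => esym (eqw x)).
have := cover_num_mono (w := w0) (w' := fun x => w0 x + (v == x)) (fun x _ => leq_addr _ _).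
rewrite eqn leq_eqVlt => /orP[/eqP eq|lt]; last first.
  apply: lex_lt1; rewrite ?leq_subr //; last exact: ltpt setT _ _ degw.
  by rewrite ltn_sub2l // (leq_trans lt) // cov_le.
have mp0 : missed w0 (pivot w).
  move: mp => /andP[pC /existsP[S /and3P[cS pS /eqP wS]]].
  rewrite /missed pC; apply/existsP; exists S; rewrite cS pS eqn_leq cover_num_le // andbT.
  rewrite eq -eqn -wS wtDs; exact: leq_addr.
have [_ /(_ _ mp0)] := pivotP w0; rewrite leq_eqVlt => /orP[/eqP eqp|ltp]; last first.
  rewrite /pivot_measure eq; apply: lex_lt2; last exact: ltpt setT _ _ degw.
  by rewrite ltn_add2l ltn_sub2l // ltn_ord.
have {}eqp : pivot w0 = pivot w by apply/enum_rank_inj/val_inj.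
rewrite /pivot_measure eq eqp ltn_add2l.
by have := eqw (pivot w); rewrite eqxx (negPf npv) addn0 addn1 => <-.
Qed.

Lemma edge_div_cover_num k w : edge_div e C k w <-> k <= cover_num w.
Proof.
split=> [dk|le].
  by have [S cS <-] := cover_num_attained w; apply: edge_div_vcover dk.
have /bipartiteP[A colA] := bipC.
apply: (koenig e_sym e_irr colA) => S cS; apply: (leq_trans le); apply: leq_trans (cover_num_le w cS) _.
by rewrite wtS // subsetIr.
Qed.

End Pivot.

(** * Lower bound for the depth *)

Section RegularElement.
Local Open Scope ring_scope.
Variables (K : fieldType) (V : finType) (e : rel V).
Hypotheses (e_sym : ssrbool.symmetric e) (e_irr : irreflexive e).
Local Notation n := #|V|.
Implicit Types (f g h : {mpoly K[n]}) (u : 'X_{1..n}) (v : V) (C : {set V}).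

Definition var_sum C : {mpoly K[n]} := \sum_(v in C) 'X_(enum_rank v).

Lemma mdeg_wt u : mdeg u = wt setT (expo u).
Proof.
rewrite mdegE /wt (reindex _ (onW_bij _ (enum_rank_bij V))); apply: eq_bigl => v.
by rewrite inE.
Qed.

Variables (C : {set V}) (x0 : V).
Hypotheses (CC : C \in components e) (bipC : bipartite e C).
Hypothesis edgeC : exists x y, [/\ x \in C, y \in C & e x y].

Local Notation piv u := (pivot e C x0 (expo u)).

Definition pivot_shift u : 'X_{1..n} := (u + vmon (piv u))%MM.

Lemma expo_pivot_shift u v : expo (pivot_shift u) v = (expo u v + (piv u == v))%N.
Proof. by rewrite expoD expo_vmon. Qed.

(* A [K]-linear map that is linear over the variables outside [C], preserves
   the powers of the edge ideal, and inverts the multiplication by [var_sum C]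
   up to terms of smaller [pivot_measure]. *)
Definition pivot_unshift h : {mpoly K[n]} :=
  \sum_(u : 'X_{1..n < msize h}) h@_(pivot_shift u) *: 'X_[u].

Lemma mcoeff_pivot_unshift h u : (pivot_unshift h)@_u = h@_(pivot_shift u).
Proof.
have [lt|ge] := ltnP (mdeg u) (msize h).
  by rewrite (mcoeff_mpoly (fun u => h@_(pivot_shift u))).
rewrite raddf_sum big1 => [|u' _].
  apply/esym/eqP; rewrite mcoeff_eq0; apply: msize_mdeg_ge.
  by rewrite (leq_trans ge) // mdegD leq_addr.
rewrite /= mcoeffZ mcoeffX; case: eqP => [eq|_]; last by rewrite mulr0.
by have := bmdeg u'; rewrite eq ltnNge ge.
Qed.

Lemma pivot_unshiftD f g : pivot_unshift (f + g) = pivot_unshift f + pivot_unshift g.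
Proof. by apply/mpolyP => u; rewrite mcoeffD !mcoeff_pivot_unshift mcoeffD. Qed.

Lemma pivot_unshift0 : pivot_unshift 0 = 0.
Proof. by apply/mpolyP => u; rewrite mcoeff_pivot_unshift !mcoeff0. Qed.

Lemma pivot_unshift_sum (I : Type) (r : seq I) (P : pred I) (F : I -> {mpoly K[n]}) :
  pivot_unshift (\sum_(i <- r | P i) F i) = \sum_(i <- r | P i) pivot_unshift (F i).
Proof. exact: (big_morph _ pivot_unshiftD pivot_unshift0). Qed.

Lemma pivot_unshiftXM v h : v \notin C ->
  pivot_unshift ('X_(enum_rank v) * h) = 'X_(enum_rank v) * pivot_unshift h.
Proof.
move=> vC; apply/mpolyP => u.
have npv u' : (piv u' == v) = false.
  by apply: contraNF vC => /eqP <-; exact: pivot_in.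
rewrite mcoeff_pivot_unshift !mcoeffXUM expo_pivot_shift npv addn0.
case: ifP => // uv; rewrite mcoeff_pivot_unshift; congr (_@__).
have expoB x : expo (u - vmon v)%MM x = (expo u x - (v == x))%N.
  by rewrite -expo_vmon /expo mnmBE.
apply: expo_inj => x; rewrite /pivot_shift expoD expoB.
have -> : piv u = piv (u - vmon v)%MM.
  apply: pivot_ext => y yC; rewrite expoB.
  by have /negPf-> : v != y; [apply: contraNneq vC => -> | rewrite subn0].
rewrite /expo mnmBE mnmDE -/(expo u x) -!/(expo (vmon _) x) !expo_vmon.
rewrite addnBAC //.
by case: eqP => // <-.
Qed.

Lemma pivot_unshift_var_sum C' h : [disjoint C' & C] ->
  pivot_unshift (h * var_sum C') = pivot_unshift h * var_sum C'.
Proof.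
move=> dis; rewrite ![_ * var_sum C']mulrC !mulr_suml pivot_unshift_sum.
by apply: eq_bigr => v vC'; rewrite pivot_unshiftXM // (disjointFr dis vC').
Qed.

(** Dividing out the pivot changes exponents only in [C], where the cover number, that is, the
    order, stays the same. *)
Lemma pivot_unshift_edge_ideal m h :
  monomial_ideal (fun u => edge_div e setT m (expo u)) h ->
  monomial_ideal (fun u => edge_div e setT m (expo u)) (pivot_unshift h).
Proof.
move=> Ih u; rewrite mcoeff_msupp mcoeff_pivot_unshift -mcoeff_msupp => /Ih.
case/(edge_div_split e_sym) => k <- dk; apply: (edge_div_glue e_sym) => D DD.
have [DC|DC] := eqVneq D C.
  rewrite DC; have := dk C CC; rewrite !(edge_div_cover_num e_sym e_irr bipC).
  by have [-> _] := cover_num_pivot bipC edgeC (expo_pivot_shift u).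
apply: edge_div_le (dk D DD) => // v vD; rewrite expo_pivot_shift.
case: eqP => [eqp|]; last by rewrite addn0.
case/eqP: DC; rewrite -(component_eq e_sym DD vD) -eqp.
exact: (component_eq e_sym CC (pivot_in x0 bipC edgeC _)).
Qed.

Lemma pivot_unshift_inverse g u : u \in msupp (g - pivot_unshift (var_sum C * g)) ->
  exists u0 v, [/\ u0 \in msupp g, v \in C, v != piv u &
    forall x, (expo u x + (piv u == x) = expo u0 x + (v == x))%N].
Proof.
rewrite mcoeff_msupp mcoeffB mcoeff_pivot_unshift mulr_suml raddf_sum /=.
(* The summand of the pivot reproduces the coefficient of [g] at [u] and cancels; what is left comes
   from the other variables of [C]. *)
rewrite (bigD1 (piv u)) ?pivot_in //= mcoeffXUM expo_pivot_shift eqxx addn1 /=.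
rewrite {1}/pivot_shift addmK opprD addNKr oppr_eq0 => nz.
have [/exists_inP[v /andP[vC npv]]|] :=
  boolP [exists (v | (v \in C) && (v != piv u)), ('X_(enum_rank v) * g)@_(pivot_shift u) != 0].
  rewrite mcoeffXUM; case: ifP => [uv nzg|]; last by rewrite eqxx.
  exists (pivot_shift u - vmon v)%MM, v; rewrite mcoeff_msupp; split=> // x.
  rewrite -expo_pivot_shift -expo_vmon -expoD submK //.
  by rewrite lep1mP -lt0n.
rewrite negb_exists_in => /forall_inP z; case/eqP: nz; apply: big1 => v /z.
by rewrite negbK => /eqP.
Qed.

(** Modulo [J], [g] may be replaced by [g - pivot_unshift (var_sum C * g)]. Degrees stay below [D]
    while the largest measure drops, so the process ends at 0. *)
Lemma var_sum_regular (J : {mpoly K[n]} -> Prop) g : is_ideal J ->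
  (forall h, J h -> J (pivot_unshift h)) -> J (var_sum C * g) -> J g.
Proof.
move=> iJ Junshift; have [J0 JD JM] := iJ.
have [D degD] : exists D, forall u, u \in msupp g -> (mdeg u < D)%N.
  by exists (msize g) => u; exact: msize_mdeg_lt.
pose mu u := pivot_measure e C x0 D (expo u).
have [N ltN] : exists N, forall u, u \in msupp g -> (mu u < N)%N.
  exists (\max_(u <- msupp g) mu u).+1 => u ug; rewrite ltnS.
  by rewrite (big_rem u) //= leq_maxl.
elim: N g degD ltN => [|N IH] g degD ltN Jfg.
  suff -> : g = 0 by [].
  by apply/msuppnil0; case: (msupp g) ltN => // u s /(_ u (mem_head _ _)).
have Jr := Junshift _ Jfg.
rewrite -[g](subrK (pivot_unshift (var_sum C * g))); apply: JD => //.
have dec u : u \in msupp (g - pivot_unshift (var_sum C * g)) ->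
    exists u0, [/\ u0 \in msupp g, mdeg u = mdeg u0 & (mu u < mu u0)%N].
  move=> /pivot_unshift_inverse[u0 [v [u0g vC npv eqx]]]; exists u0.
  have deg : mdeg u = mdeg u0.
    apply: (@addIn 1%N); rewrite -{1}(mdeg1 (enum_rank (piv u))) -(mdeg1 (enum_rank v)) -!mdegD.
    by congr mdeg; apply: expo_inj => x; rewrite !expoD !expo_vmon eqx.
  split=> //; apply: (pivot_measure_lt bipC edgeC vC npv) => //.
  by rewrite -mdeg_wt ltnW // degD.
apply: IH => [u|u|].
- by case/dec => u0 [u0g -> _]; exact: degD.
- by case/dec => u0 [u0g _ lt]; rewrite -ltnS (leq_ltn_trans lt) // ltN.
- by rewrite mulrBr; apply: idealB => //; exact: JM.
Qed.

End RegularElement.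

Section RegularSequence.
Local Open Scope ring_scope.
Variables (K : fieldType) (V : finType) (e : rel V).
Hypotheses (e_sym : ssrbool.symmetric e) (e_irr : irreflexive e)
  (no_isolated : forall x : V, exists y : V, e x y).
Local Notation n := #|V|.

Definition bip_components := [set C in components e | bipartite e C].

Lemma component_edge C : C \in components e -> exists x y, [/\ x \in C, y \in C & e x y].
Proof.
move=> CC; have /set0Pn[x xC] := components_neq0 CC; have [y exy] := no_isolated x.
by exists x, y; split=> //; exact: (components_closed e_sym CC xC).
Qed.

Lemma var_sum_regular_seq m : (0 < m)%N ->
  regular_seq_in (@irrelevant_ideal K n) (ideal_exp (edge_ideal K e) m)
    [seq var_sum K C | C <- enum bip_components].
Proof.
move=> m_gt0; split=> [_ /mapP[C _ ->]|].
  apply: ideal_sum; first exact: ideal_gen_ideal.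
  by move=> v _; apply: ideal_gen_base; exists (enum_rank v).
split.
  move=> i; rewrite size_map => lti g.
  set cs := enum _ in lti *; rewrite (nth_map set0) // -map_take.
  set C := nth set0 cs i; set J := ideal_adjoin _ _.
  have : C \in bip_components by rewrite -mem_enum mem_nth.
  rewrite inE => /andP[CC bipC]; have [x0 _] := set0Pn _ (components_neq0 CC).
  apply: (var_sum_regular (x0 := x0) bipC (component_edge CC)).
    exact: ideal_gen_ideal.
  move=> h [k [a [b [Jb ->]]]]; rewrite pivot_unshift_sum.
  apply: ideal_sum => [|j _]; first exact: ideal_gen_ideal.
  case: (Jb j) => [Ib|/mapP[C' C'cs ->]].
    apply: ideal_gen_base; left; apply/edge_ideal_expP/pivot_unshift_edge_ideal => //.
      exact: component_edge.
    by apply/edge_ideal_expP; have [_ _] := ideal_gen_ideal _ : is_ideal (ideal_exp (edge_ideal K e) m); apply.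
  (* The earlier sums belong to components disjoint from [C], over whose variables [pivot_unshift]
     is linear. *)
  rewrite pivot_unshift_var_sum //; last 1 first.
  - apply/pred0P => x; apply/negP => /andP[/= xC' xC].
    have C'C : C' \in components e.
      by have := mem_take C'cs; rewrite mem_enum inE => /andP[].
    have : uniq (take i cs ++ C :: drop i.+1 cs).
      by rewrite -drop_nth // cat_take_drop enum_uniq.
    rewrite cat_uniq /= negb_or => /and3P[_ /andP[+ _] _] => /negP[].
    by rewrite -(component_eq e_sym CC xC) (component_eq e_sym C'C xC').
  - have [_ _ JM] := ideal_gen_ideal _ : is_ideal J; apply: JM.
    by apply: ideal_gen_base; right; apply: map_f.
  - exact: component_edge.
(* The ideal is proper: as [m] is positive, its elements have constant term 0. *)
suff : forall f, ideal_adjoin (ideal_exp (edge_ideal K e) m)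
    [seq var_sum K C | C <- enum bip_components] f -> f@_0%MM = 0.
  by move=> + one => /(_ _ one)/eqP; rewrite mcoeff1 eqxx oner_eq0.
apply: ideal_gen_min.
  split; first exact: mcoeff0.
    by move=> f g f0 g0; rewrite mcoeffD f0 g0 addr0.
  by move=> a f f0; rewrite rmorphM /= f0 mulr0.
move=> f [/edge_ideal_expP If|/mapP[C _ ->]].
  apply/eqP; rewrite mcoeff_eq0; apply/negP => /If[E [sE _ dE]].
  case: E sE dE m_gt0 => [<-|p E _ /(_ p.1 (in_setT _))] //.
  by rewrite /expo mnm0E /dg big_cons eqxx.
rewrite raddf_sum big1 //= => v _; rewrite mcoeffX.
by rewrite mnm1_eq0.
Qed.

End RegularSequence.

(** * Upper bound for the depth *)

Section Wedge.
Local Open Scope ring_scope.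
Variables (R : comNzRingType) (V : finType).
Implicit Types (x y : V -> R) (c : seq V -> R) (s t : seq V).

Lemma eq_in_kd x y c t : {in t, x =1 y} -> kd x c t = kd y c t.
Proof.
elim: t c => //= v t IH c eqxy; rewrite eqxy ?mem_head //; congr (_ - _).
by apply: IH => z zt; apply: eqxy; rewrite inE zt orbT.
Qed.

Lemma kd_sum_weight (I : Type) (r : seq I) (P : pred I) (x : I -> V -> R) c t :
  kd (fun v => \sum_(i <- r | P i) x i v) c t = \sum_(i <- r | P i) kd (x i) c t.
Proof.
elim: t c => [|v t IH] c /=; first by rewrite big1.
by rewrite IH mulr_suml sumrB.
Qed.

Lemma kd_weight0 x c t : {in t, forall v, x v = 0} -> kd x c t = 0.
Proof.
elim: t c => //= v t IH c x0; rewrite x0 ?mem_head // mul0r IH ?subr0 // => z zt.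
by rewrite x0 // inE zt orbT.
Qed.

Lemma kd_eq0 x c t : (forall s, {subset s <= t} -> c s = 0) -> kd x c t = 0.
Proof.
elim: t c => //= v t IH c c0; rewrite c0 => [|z zt]; last by rewrite inE zt orbT.
rewrite IH ?mulr0 ?subr0 // => s st; apply: c0 => z; rewrite !inE => /predU1P[->|/st->].
  by rewrite eqxx.
by rewrite orbT.
Qed.

Variables (I : eqType) (chi : I -> V -> R).

(* The exterior product of the linear forms [chi i], [i] in [r]. *)
Definition wedge (r : seq I) : seq V -> R :=
  foldr (fun i => kd (chi i)) (fun t => (t == [::])%:R) r.

Lemma kd_wedge i r t : i \in r -> kd (chi i) (wedge r) t = 0.
Proof.
elim: r t => //= j r IH t; rewrite inE => /predU1P[->|ir]; first exact: kd_kd.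
rewrite kd_anticomm; apply/eqP; rewrite oppr_eq0; apply/eqP.
by apply: kd_eq0 => s _; exact: IH.
Qed.

Lemma wedge_eq0 i r t : i \in r -> {in t, forall v, chi i v = 0} -> wedge r t = 0.
Proof.
elim: r t => //= j r IH t; rewrite inE => ir chi0.
have [eij|nij] := eqVneq i j; first by rewrite -eij; exact: kd_weight0.
apply: kd_eq0 => s st; apply: IH => [|v /st/chi0//].
by move: ir; rewrite (negPf nij).
Qed.

End Wedge.

Section CrossPolytope.
Local Open Scope ring_scope.
Variables (K : fieldType) (V : finType).
Local Notation n := #|V|.
Implicit Types (u : 'X_{1..n}) (s t : seq V) (c b : seq V -> {mpoly K[n]}) (l : seq (V * V)).

Definition seq_mon t : 'X_{1..n} := (\sum_(v <- t) vmon v)%MM.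

Lemma seq_mon_cons v t : seq_mon (v :: t) = (vmon v + seq_mon t)%MM.
Proof. exact: big_cons. Qed.

Lemma expo_seq_mon t v : expo (seq_mon t) v = count_mem v t.
Proof.
elim: t => [|x t IH]; first by rewrite /expo /seq_mon big_nil mnm0E.
by rewrite seq_mon_cons expoD expo_vmon IH.
Qed.

Definition var v : {mpoly K[n]} := 'X_(enum_rank v).

(** Stripping the monomials from multigraded cochains turns the Koszul differential into the
    simplicial coboundary [kd (fun=> 1)]. *)
Lemma kd_monomial u (D : seq V -> {mpoly K[n]}) t :
  kd var (fun s => 'X_[u + seq_mon s] * D s) t = 'X_[u + seq_mon t] * kd (fun=> 1) D t.
Proof.
elim: t u D => [|v t IH] u D /=; first by rewrite mulr0.
rewrite (@eq_kd _ _ _ _ (fun s => 'X_[(u + vmon v) + seq_mon s] * D (v :: s))); last first.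
  by move=> s; rewrite seq_mon_cons addmA.
rewrite IH mulrBr seq_mon_cons addmA; congr (_ - _).
by rewrite mul1r mulrA -mpolyXD addmA (addmC _ u).
Qed.

(* Evaluation on the fundamental cycle of a cross-polytope whose pairs of
   opposite vertices are the entries of [l], in degree [u] plus the vertices. *)
Fixpoint cross_eval l u c : K :=
  if l is p :: l' then
    cross_eval l' (u + vmon p.1)%MM (fun s => c (p.1 :: s)) -
    cross_eval l' (u + vmon p.2)%MM (fun s => c (p.2 :: s))
  else (c [::])@_u.

Fixpoint cross_facet l s : bool :=
  match l, s with
  | p :: l', v :: s' => ((v == p.1) || (v == p.2)) && cross_facet l' s'
  | [::], [::] => true
  | _, _ => false
  end.

Lemma cross_evalB l u c b :
  cross_eval l u (fun s => c s - b s) = cross_eval l u c - cross_eval l u b.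
Proof.
elim: l u c b => [|p l IH] u c b /=; first by rewrite mcoeffB.
by rewrite !IH; ring.
Qed.

Lemma cross_eval_eq0 l u c :
  (forall s, cross_facet l s -> (c s)@_(u + seq_mon s) = 0) -> cross_eval l u c = 0.
Proof.
elim: l u c => [|p l IH] u c c0 /=.
  by have := c0 [::] isT; rewrite /seq_mon big_nil addm0.
by rewrite !IH ?subrr // => s ls; rewrite -addmA -seq_mon_cons c0 //= eqxx ?orbT.
Qed.

Lemma eq_cross_eval l u c b :
  (forall s, cross_facet l s -> c s = b s) -> cross_eval l u c = cross_eval l u b.
Proof.
move=> eqcb; apply/eqP; rewrite -subr_eq0 -cross_evalB; apply/eqP/cross_eval_eq0 => s /eqcb->.
by rewrite subrr mcoeff0.
Qed.

Lemma cross_eval_shift l u v c :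
  cross_eval l (u + vmon v)%MM (fun s => var v * c s) = cross_eval l u c.
Proof.
elim: l u c => [|p l IH] u c /=; first by rewrite mulrC addmC mcoeffMX.
have AC u' : (u + vmon v + u' = u + u' + vmon v)%MM by rewrite -!addmA (addmC u').
by rewrite !AC !IH.
Qed.

(** At a pair of opposite vertices, the terms that carry their variables both evaluate to
    [cross_eval l u b] and cancel; the rest vanishes by induction. *)
Lemma cross_eval_kd l u b : cross_eval l u (kd var b) = 0.
Proof.
elim: l u b => [|p l IH] u b /=; first by rewrite mcoeff0.
by rewrite !cross_evalB !cross_eval_shift !IH; ring.
Qed.

End CrossPolytope.

Section Depth.
Local Open Scope ring_scope.
Variables (K : fieldType) (V : finType) (e : rel V).
Hypotheses (e_sym : ssrbool.symmetric e)
  (no_isolated : forall x : V, exists y : V, e x y).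
Local Notation n := #|V|.
Variable A : {set V}.
Hypothesis colA : forall C, C \in components e -> bipartite e C -> two_colored e C A.

(** This indicator separates the two simplices of [C]; the exterior product of all of them
    represents the class of the join. *)
Let chi (C : {set V}) v : {mpoly K[n]} := ((v \in C) && (v \in A))%:R.

Let cs := enum (bip_components e).

Lemma in_cs C : C \in cs -> C \in components e /\ bipartite e C.
Proof. by rewrite mem_enum inE => /andP. Qed.

(** If the face meets [A] in every bipartite component, then on it the form 1 is the sum of the
    [chi C], each of which annihilates the product. Otherwise some [chi C] vanishes on the face, and
    so does the product. *)
Lemma kd_wedge_face t : face e A t -> kd (fun=> 1) (wedge chi cs) t = 0.
Proof.
move=> ft; have [/allP H|/allPn[C Ccs]] :=
    boolP (all (fun C : {set V} => has (fun v => (v \in C) && (v \in A)) t) cs).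
  rewrite (@eq_in_kd _ _ _ (fun v => \sum_(C <- cs) chi C v)).
    by rewrite kd_sum_weight big_seq big1 // => C; exact: kd_wedge.
  move=> v vt; have /andP[bipv sidev] := allP ft v vt.
  have vcs : component e v \in cs by rewrite mem_enum inE component_in.
  have vA : v \in A.
    have /hasP[y yt /andP[yC yA]] := H _ vcs.
    by have := allP sidev y yt; rewrite -in_component yC yA => /eqP.
  rewrite (bigD1_seq (component e v)) ?enum_uniq //= /chi component_refl vA big_seq_cond big1 ?addr0 //.
  move=> C /andP[/in_cs[CC _] neq]; case: (boolP (v \in C)) => // vC.
  by rewrite (component_eq e_sym CC vC) eqxx in neq.
move=> /hasPn notA; apply: kd_eq0 => s st; apply: (wedge_eq0 Ccs) => v /st/notA.
by rewrite /chi => /negPf->.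
Qed.

Definition opposite_pairs (r : seq {set V}) (l : seq (V * V)) : bool :=
  all2 (fun (C : {set V}) (p : V * V) => [&& p.1 \in C, p.2 \in C, p.1 \in A & p.2 \notin A]) r l.

Lemma opposite_pairs_exists : exists l, opposite_pairs cs l.
Proof.
have : {subset cs <= cs} by [].
elim: {1 3}cs => [|C r IH] sub; first by exists [::].
have [|l rl] := IH; first by move=> D Dr; apply: sub; rewrite inE Dr orbT.
have /in_cs[CC bipC] := sub C (mem_head _ _).
have [x [y [xC yC exy]]] := component_edge e_sym no_isolated CC.
have := colA CC bipC xC yC exy; case: (boolP (x \in A)) => xA yA; [exists ((x, y) :: l)|exists ((y, x) :: l)].
  by rewrite /opposite_pairs /= xC yC xA -/(opposite_pairs r l) rl; case: (y \in A) yA.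
by rewrite /opposite_pairs /= xC yC xA -/(opposite_pairs r l) rl; case: (y \in A) yA.
Qed.

Lemma cross_facet_component r l s : {subset r <= cs} -> opposite_pairs r l ->
  cross_facet l s -> {in s, forall v, component e v \in r}.
Proof.
elim: r l s => [|C r IH] [|p l] [|v s] //= sub /andP[/and4P[pC pC' _ _] rl] /andP[vp ls] x.
have [CC _] := in_cs (sub C (mem_head _ _)).
rewrite !inE => /predU1P[->|xs].
  by rewrite (component_eq e_sym CC) ?eqxx //; case/orP: vp => /eqP->.
by rewrite (IH l s) ?orbT // => D Dr; apply: sub; rewrite inE Dr orbT.
Qed.

Lemma cross_facet_inj r l s : {subset r <= cs} -> uniq r -> opposite_pairs r l ->
  cross_facet l s -> {in s &, forall x y, component e x = component e y -> x = y}.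
Proof.
elim: r l s => [|C r IH] [|p l] [|v s] //= sub /andP[Cr ur] /andP[/and4P[pC pC' _ _] rl] /andP[vp ls].
have sub' : {subset r <= cs} by move=> D Dr; apply: sub; rewrite inE Dr orbT.
have vC : component e v = C.
  have [CC _] := in_cs (sub C (mem_head _ _)).
  by apply: (component_eq e_sym CC); case/orP: vp => /eqP->.
have notC z : z \in s -> component e z <> C.
  by move=> zs zC; case/negP: Cr; rewrite -zC (cross_facet_component sub' rl ls).
move=> x y; rewrite !inE => /predU1P[->|xs] /predU1P[->|ys] //.
- by rewrite vC => /esym/notC; case.
- by rewrite vC => /notC; case.
exact: (IH l s).
Qed.

Lemma cross_facet_face l s : opposite_pairs cs l -> cross_facet l s -> face e A s.
Proof.
move=> csl ls; apply/allP => x xs.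
have /in_cs[_ ->] := cross_facet_component (fun=> id) csl ls xs.
apply/allP => y ys; apply/implyP => xy.
suff -> : x = y by [].
apply: (cross_facet_inj (r := cs) _ _ csl ls) xs ys _ => //; first exact: enum_uniq.
by apply/esym/(component_eq e_sym (component_in _ _)); rewrite in_component.
Qed.

(** In each pair only the vertex in [A] contributes, with [chi C] equal to 1; the later vertices lie
    in other components, where [chi C] is 0. *)
Lemma cross_eval_wedge r l u : {subset r <= cs} -> uniq r -> opposite_pairs r l ->
  cross_eval l u (fun s => 'X_[u + seq_mon s] * wedge chi r s) = 1.
Proof.
elim: r l u => [|C r IH] [|p l] u //= sub.
  by move=> _; rewrite /seq_mon big_nil addm0 mulr1 mcoeffX eqxx.
move=> /andP[Cr ur] /andP[/and4P[pC pC' pA pA'] rl].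
have sub' : {subset r <= cs} by move=> D Dr; apply: sub; rewrite inE Dr orbT.
have kd0 c s : cross_facet l s -> kd (chi C) c s = 0.
  move=> ls; apply: kd_weight0 => v vs; rewrite /chi; case: (boolP (v \in C)) => // vC.
  have [CC _] := in_cs (sub C (mem_head _ _)).
  have := cross_facet_component sub' rl ls vs.
  by rewrite (component_eq e_sym CC vC) (negPf Cr).
rewrite (eq_cross_eval _ (b := fun s => 'X_[(u + vmon p.1) + seq_mon s] * wedge chi r s)).
  rewrite IH // cross_eval_eq0 ?subr0 // => s ls.
  by rewrite kd0 // /chi (negPf pA') andbF mul0r subrr mulr0 mcoeff0.
move=> s ls; rewrite kd0 // /chi pC pA mul1r subr0.
by rewrite seq_mon_cons addmA.
Qed.

(** The cochain [c] is a cocycle modulo the power: on faces by [kd_wedge_face], elsewhere because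
    the monomial lies in the power. A longer regular sequence would make it a coboundary, but the
    cross-polytope evaluates [c] to 1, coboundaries to 0, and values in the power to 0 since its
    facets are faces. *)
Lemma depth_le_bip_components m u fs :
  (forall t, edge_div e setT m (expo (u + seq_mon t)%MM) <-> ~~ face e A t) ->
  regular_seq_in (@irrelevant_ideal K n) (ideal_exp (edge_ideal K e) m) fs ->
  (size fs <= #|bip_components e|)%N.
Proof.
move=> uP [Mfs regfs]; rewrite leqNgt; apply/negP => lt.
have iJ : is_ideal (ideal_exp (edge_ideal K e) m) by exact: ideal_gen_ideal.
pose c s : {mpoly K[n]} := 'X_[u + seq_mon s] * wedge chi cs s.
have [|t _|b cb] := @koszul_acyclic _ _ (@var K V) _ fs c #|bip_components e| iJ _ lt.
- split=> // f /Mfs; apply: ideal_gen_min; first exact: ideal_gen_ideal.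
  move=> _ [i ->]; apply: ideal_gen_base; exists (enum_val i).
  by rewrite /var enum_valK.
- rewrite kd_monomial; have [ft|nft] := boolP (face e A t).
    by rewrite kd_wedge_face // mulr0; case: iJ.
  rewrite mulrC; have [_ _ JM] := iJ; apply: (JM _ 'X_[u + seq_mon t]).
  by apply/edge_ideal_expP; apply: monomial_idealX; exact: (proj2 (uP t) nft).
have [l csl] := opposite_pairs_exists.
suff : cross_eval l u (fun s => c s - kd (@var K V) b s) = 0.
  rewrite cross_evalB cross_eval_kd subr0 cross_eval_wedge ?enum_uniq // => /eqP.
  by rewrite oner_eq0.
apply: cross_eval_eq0 => s ls.
have size_s r l' s' : opposite_pairs r l' -> cross_facet l' s' -> size s' = size r.
  by elim: r l' s' => [|C r IH] [|p l'] [|v s'] //= /andP[_ rl] /andP[_ /IH->].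
have /cb/edge_ideal_expP cbs : size s = #|bip_components e|.
  by rewrite (size_s _ _ _ csl ls) -cardE.
apply/eqP; rewrite mcoeff_eq0; apply/negP => /cbs /(proj1 (uP s)).
by rewrite (cross_facet_face csl ls).
Qed.

End Depth.

(** * Stabilization of the depth *)

Lemma classical_least (P : nat -> Prop) N : P N ->
  exists n, [/\ n <= N, P n & forall k, P k -> n <= k].
Proof.
have [M] := ubnP N; elim: M N => // M IH N /ltnSE leN PN.
have [[k [ltk Pk]]|nok] := classic (exists k, k < N /\ P k).
  have [n [len Pn minn]] := IH k (leq_trans ltk leN) Pk.
  by exists n; split=> //; apply: leq_trans len (ltnW ltk).
exists N; split=> // k Pk; rewrite leqNgt; apply/negP => ltk.
by apply: nok; exists k.
Qed.

Theorem theorem4p6 (K : fieldType) (V : finType) (e : rel V)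
  (e_sym : ssrbool.symmetric e) (e_irr : irreflexive e)
  (no_isolated : forall x : V, exists y : V, e x y) :
  exists2 d : nat, is_dstab (edge_ideal K e) d &
    (d%:Z <= #|V|%:Z - #|leaf_edges e|%:Z
             - \sum_(C in components e) (comp_k e C)%:Z + 1)%R.
Proof.
have [A [N [colA leN core]]] := global_core e_sym e_irr no_isolated.
have depthN m : N < m -> depth_quot (ideal_exp (edge_ideal K e) m) #|bip_components e|.
  move=> ltm; split.
    exists [seq var_sum K C | C <- enum (bip_components e)]; last by rewrite size_map -cardE.
    by apply: var_sum_regular_seq => //; exact: leq_ltn_trans ltm.
  have [w wP] := core m ltm; move=> fs.
  apply: (depth_le_bip_components e_sym no_isolated colA (u := [multinom w (enum_val i) | i < #|V|])).
  move=> t; rewrite -wP; split; apply: edge_div_le => // v _;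
    by rewrite expoD expo_seq_mon /expo mnmE enum_rankK.
(* From [N.+1] on the depth is the number of bipartite components; the successor becomes the summand
   1 of the bound. *)
have [d [led [d1 std] mind]] := @classical_least
  (fun d => 1 <= d /\ depth_stable_from (edge_ideal K e) d) N.+1
  (conj isT (fun m ltm => ex_intro2 _ _ _ (depthN m ltm) (depthN _ (leqnn _)))).
exists d; first by split=> // k k1 stk; apply: mind.
rewrite -(big_morph _ PoszD (erefl _)).
by move: led leN; clear; lia.
Qed.
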